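(* Let $u \in \widetilde{\mathbf{E}}^+$ with $\operatorname{val}_X(u) > 0$, and suppose that $u \circ \gamma_a = \gamma_a \circ u$ for all $a \in \mathbf{Z}_p^\times$. Then there exist $b \in \mathbf{Z}_p^\times$ and $n \in \mathbf{Z}$ such that $u = \gamma_b(X^{p^n})$.
   Context: Here $E = \mathbf{F}_p$. Let $\widetilde{\mathbf{E}}^+$ be the $X$-adic completion of $\bigcup_{n\ge0}\mathbf{F}_p[[X^{1/p^n}]]$, with $X$-adic valuation $\operatorname{val}_X$ ($\operatorname{val}_X(X)=1$). For $a\in\mathbf{Z}_p^\times$ let $\gamma_a(X) = (1+X)^a - 1 \in \mathbf{F}_p[[X]]$. The group $\mathbf{Z}_p^\times$ acts on $\widetilde{\mathbf{E}}^+$ by continuous ring automorphisms determined by $a\cdot X^{1/p^n} = (1+X^{1/p^n})^a-1$, and $u\circ\gamma_a$ denotes $a\cdot u$. For $u$ with $\operatorname{val}_X(u)>0$, $\gamma_a \circ u$ denotes $(1+u)^a - 1 = \sum_{n\ge1}\binom{a}{n}u^n$ (convergent in $\widetilde{\mathbf{E}}^+$). For $n\in\mathbf{Z}$, $X^{p^n}$ denotes $X^{1/p^{-n}}$ when $n<0$.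
   Formalization: The formal statement adds the hypothesis u ≠ 0: with val_X(0) = +∞, u = 0 satisfies every hypothesis, but γ_b(X^{p^n}) is never 0 for a unit b. *)

(* Defs.v *)
From HB Require Import structures.
From mathcomp Require Import all_boot all_order all_algebra.
From mathcomp Require Import boolp classical_sets cardinality fsbigop constructive_ereal.
From mathcomp Require Import zify ring lra.

Set Implicit Arguments.
Unset Strict Implicit.
Unset Printing Implicit Defensive.

Import Order.TTheory GRing.Theory Num.Theory.
Local Open Scope ring_scope.

(* The p-adic integers: [pres a n] is the residue of [a] modulo [p ^ n]. *)
Record padic (p : nat) (p_pr : prime p) := Padic {
  pres :> nat -> nat;
  presP : forall n, pres n = (pres n.+1 %% p ^ n)%N }.

Section PadicRing.
Variables (p : nat) (p_pr : prime p).
Local Notation Zp := (padic p_pr).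
Implicit Types a b c : Zp.

Lemma pX_gt0 n : (0 < p ^ n)%N. Proof. by rewrite expn_gt0 prime_gt0. Qed.

Lemma padicP a b : a =1 b -> a = b.
Proof.
case: a b => [a Ha] [b Hb] /= /funext E; subst b.
by congr Padic; apply: Prop_irrelevance.
Qed.

Lemma pres_modS n x : ((x %% p ^ n.+1) %% p ^ n = x %% p ^ n)%N.
Proof. by rewrite modn_dvdm // dvdn_exp2l. Qed.

Lemma pres_id a n : (a n %% p ^ n = a n)%N.
Proof. by rewrite presP modn_mod. Qed.

Lemma pres_mod a m n : (m <= n)%N -> (a n %% p ^ m = a m)%N.
Proof.
move=> /subnKC <-; elim: (n - m)%N => [|k IH]; first by rewrite addn0 pres_id.
by rewrite addnS -IH (presP a (m + k)) modn_dvdm // dvdn_exp2l // leq_addr.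
Qed.

HB.instance Definition _ := gen_eqMixin Zp.
HB.instance Definition _ := gen_choiceMixin Zp.

Definition padic_of_nat (x : nat) : Zp :=
  @Padic p p_pr (fun n => x %% p ^ n)%N (fun n => esym (pres_modS n x)).

Fact padic_add_subproof a b n :
  ((a n + b n) %% p ^ n = (a n.+1 + b n.+1) %% p ^ n.+1 %% p ^ n)%N.
Proof. by rewrite pres_modS (presP a) (presP b) modnDm. Qed.
Definition padic_add a b : Zp :=
  @Padic p p_pr (fun n => (a n + b n) %% p ^ n)%N (padic_add_subproof a b).

Fact padic_mul_subproof a b n :
  ((a n * b n) %% p ^ n = (a n.+1 * b n.+1) %% p ^ n.+1 %% p ^ n)%N.
Proof. by rewrite pres_modS (presP a) (presP b) modnMm. Qed.
Definition padic_mul a b : Zp :=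
  @Padic p p_pr (fun n => (a n * b n) %% p ^ n)%N (padic_mul_subproof a b).

Fact padic_opp_subproof a n :
  ((p ^ n - a n) %% p ^ n = (p ^ n.+1 - a n.+1) %% p ^ n.+1 %% p ^ n)%N.
Proof.
rewrite pres_modS.
have le k : (a k <= p ^ k)%N by rewrite -(pres_id a k) ltnW // ltn_pmod ?pX_gt0.
apply/eqP; rewrite -(eqn_modDr (a n.+1)) (subnK (le n.+1)).
rewrite -modnDmr -presP (subnK (le n)) modnn eq_sym; apply/eqP.
by rewrite expnS modnMl.
Qed.
Definition padic_opp a : Zp :=
  @Padic p p_pr (fun n => (p ^ n - a n) %% p ^ n)%N (padic_opp_subproof a).

Fact padic_addA : associative padic_add.
Proof. by move=> a b c; apply: padicP => n /=; rewrite modnDmr modnDml addnA. Qed.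
Fact padic_addC : commutative padic_add.
Proof. by move=> a b; apply: padicP => n /=; rewrite addnC. Qed.
Fact padic_add0 : left_id (padic_of_nat 0) padic_add.
Proof. by move=> a; apply: padicP => n /=; rewrite modnDml add0n pres_id. Qed.
Fact padic_addN : left_inverse (padic_of_nat 0) padic_opp padic_add.
Proof.
move=> a; apply: padicP => n /=; rewrite modnDml subnK ?modnn ?mod0n //.
by rewrite -(pres_id a n) ltnW // ltn_pmod ?pX_gt0.
Qed.
HB.instance Definition _ :=
  GRing.isZmodule.Build Zp padic_addA padic_addC padic_add0 padic_addN.

Fact padic_mulA : associative padic_mul.
Proof. by move=> a b c; apply: padicP => n /=; rewrite modnMmr modnMml mulnA. Qed.
Fact padic_mulC : commutative padic_mul.
Proof. by move=> a b; apply: padicP => n /=; rewrite mulnC. Qed.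
Fact padic_mul1 : left_id (padic_of_nat 1) padic_mul.
Proof. by move=> a; apply: padicP => n /=; rewrite modnMml mul1n pres_id. Qed.
Fact padic_mulD : left_distributive padic_mul padic_add.
Proof.
by move=> a b c; apply: padicP => n /=; rewrite modnMml mulnDl modnDm.
Qed.
Fact padic_one_neq0 : padic_of_nat 1 != padic_of_nat 0.
Proof.
apply/eqP => /(congr1 (fun a : Zp => a 1%N)) /=.
by rewrite expn1 mod0n modn_small // prime_gt1.
Qed.
HB.instance Definition _ := GRing.Zmodule_isComNzRing.Build Zp
  padic_mulA padic_mulC padic_mul1 padic_mulD padic_one_neq0.

Lemma pres_add a b n : (a + b) n = ((a n + b n) %% p ^ n)%N. Proof. by []. Qed.
Lemma pres_mul a b n : (a * b) n = ((a n * b n) %% p ^ n)%N. Proof. by []. Qed.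
Lemma pres_natr x n : (x%:R : Zp) n = (x %% p ^ n)%N.
Proof.
elim: x => [//|x IH]; rewrite -addn1 natrD pres_add IH /=.
by rewrite modnDm.
Qed.

Definition padic_unit a : bool := `[< exists b, b * a = 1 >].
Definition padic_inv a : Zp :=
  if pselect (exists b, b * a = 1) is left h then sval (cid h) else a.
Fact padic_mulV : {in padic_unit, left_inverse 1 padic_inv *%R}.
Proof.
move=> a /asboolP h; rewrite /padic_inv; case: pselect => // h'.
by case: cid.
Qed.
Fact padic_unitP a b : b * a = 1 -> padic_unit a.
Proof. by move=> h; apply/asboolP; exists b. Qed.
Fact padic_inv_out : {in [predC padic_unit], padic_inv =1 id}.
Proof.
move=> a; rewrite !inE => /asboolPn h; rewrite /padic_inv.
by case: pselect.
Qed.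
HB.instance Definition _ := GRing.ComNzRing_hasMulInverse.Build Zp
  padic_mulV padic_unitP padic_inv_out.


Lemma pres_eq_add n a a' b b' :
  a n = a' n -> b n = b' n -> (a + b) n = (a' + b') n.
Proof. by rewrite !pres_add => -> ->. Qed.
Lemma pres_eq_mul n a a' b b' :
  a n = a' n -> b n = b' n -> (a * b) n = (a' * b') n.
Proof. by rewrite !pres_mul => -> ->. Qed.

Lemma ffact_prodr (R : comNzRingType) (x n : nat) :
  (x ^_ n)%:R = \prod_(i < n) (x%:R - i%:R) :> R.
Proof.
elim: n => [|n IH]; first by rewrite big_ord0.
rewrite big_ord_recr /= ffactnSr natrM IH.
case: (leqP n x) => h; first by rewrite natrB.
rewrite (_ : \prod_(i < n) _ = 0) ?mul0r //.
by rewrite -IH ffact_small.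
Qed.

Lemma bin_congr n k x y : (x = y %[mod p ^ (k + logn p n`!)] ->
  'C(x, n) = 'C(y, n) %[mod p ^ k])%N.
Proof.
move=> E; set q := (k + _)%N in E.
have E' : (x%:Z = y%:Z %[mod (p ^ q)%:Z])%Z by rewrite !modz_nat E.
have F : ((p ^ q)%:Z %| (x ^_ n)%:Z - (y ^_ n)%:Z)%Z.
  rewrite -!natz !ffact_prodr -eqz_mod_dvd; apply/eqP.
  elim/big_ind2: _ => //.
    by move=> a a' b b' h1 h2; rewrite -modzMm h1 h2 modzMm.
  by move=> i _; rewrite !natz -modzDml E' modzDml.
rewrite -!bin_ffact !PoszM -mulrBl in F.
have : ((p ^ k)%:Z %| 'C(x, n)%:Z - 'C(y, n)%:Z)%Z.
  move: F; rewrite !dvdzE /= abszM /= mulnC.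
  set D := `|_|%N; have f0 := fact_gt0 n.
  rewrite /q expnD; have [m m_p Em] := pfactor_coprime p_pr f0.
  rewrite [in X in (_ %| X)%N]Em -mulnA [X in (_ %| X)%N -> _]mulnCA mulnC.
  rewrite dvdn_pmul2l ?pX_gt0 // => h.
  by rewrite -(Gauss_dvdr _ (_ : coprime _ m)) // coprimeXl.
by rewrite -eqz_mod_dvd !modz_nat => /eqP [].
Qed.

Fact padic_bin_subproof a n k :
  ('C(a (k + logn p n`!), n) %% p ^ k =
   'C(a (k.+1 + logn p n`!), n) %% p ^ k.+1 %% p ^ k)%N.
Proof.
rewrite pres_modS; apply: bin_congr.
by rewrite pres_id pres_mod // leq_add2r.
Qed.

(* Since [n! * 'C(x, n)] is a polynomial in [x], the value of [x] modulo
   [p ^ (k + v_p(n!))] determines ['C(x, n)] modulo [p ^ k]; [padic_binE]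
   states that the result is the usual [a (a - 1) ... (a - n + 1) / n!]. *)
Definition padic_bin a n : Zp :=
  @Padic p p_pr (fun k => 'C(a (k + logn p n`!), n) %% p ^ k)%N
    (padic_bin_subproof a n).

Lemma padic_binE a n :
  n`!%:R * padic_bin a n = \prod_(i < n) (a - i%:R).
Proof.
apply: padicP => k; rewrite pres_mul pres_natr /= modnMm mulnC bin_ffact.
rewrite -pres_natr ffact_prodr.
elim/big_ind2: _ => //.
  by move=> b b' c c'; apply: pres_eq_mul.
move=> i _; apply: pres_eq_add => //.
by rewrite pres_natr pres_mod // leq_addr.
Qed.

Definition padic_red a : 'F_p := (a 1%N)%:R.

End PadicRing.

(* [in_level n f] says that the family of coefficients [f] is supported in
   [p ^- n N], i.e. that [\sum_i f i X^i] lies in F_p[[X^(1/p^n)]]. *)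
Definition in_level (p n : nat) (f : rat -> 'F_p) : Prop :=
  forall i, f i != 0 -> exists k : nat, i = k%:R / p%:R ^+ n.

(* The X-adic completion of the union of the F_p[[X^(1/p^n)]], realised as
   the closure of this union in the space of all formal sums [\sum_i c_i X^i]
   with rational exponents, for the topology in which two sums are close when
   their coefficients of exponent [< N] agree.  That it is the completion is
   recorded by [Etilde_complete], [Etilde_dense] and [valX_ge_divX]. *)
Record Etilde (p : nat) (p_pr : prime p) := MkEtilde {
  coefE :> rat -> 'F_p;
  coefEP : forall N : nat, exists n f,
    in_level n f /\ forall i, i < N%:R -> coefE i = f i }.

Section EtildeRing.
Variables (p : nat) (p_pr : prime p).
Local Notation E := (Etilde p_pr).
Implicit Types (u v w : E) (f g : rat -> 'F_p).

Local Notation q n := (p%:R ^+ n : rat).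
Local Notation xp n k := (k%:R / q n).

Lemma q_gt0 n : 0 < q n. Proof. by rewrite exprn_gt0 // ltr0n prime_gt0. Qed.
Lemma q_neq0 n : q n != 0. Proof. by rewrite gt_eqF // q_gt0. Qed.

Lemma xp_lt n (k l : nat) : (xp n k < xp n l) = (k < l)%N.
Proof. by rewrite ltr_pM2r ?invr_gt0 ?q_gt0 // ltr_nat. Qed.
Lemma xp_ltN n (k N : nat) : (xp n k < N%:R) = (k < N * p ^ n)%N.
Proof. by rewrite ltr_pdivrMr ?q_gt0 // -natrX -natrM ltr_nat. Qed.
Lemma xp_inj n : injective (fun k : nat => xp n k).
Proof.
move=> k l /(congr1 (fun x => x * q n)); rewrite !divfK ?q_neq0 //.
by move/eqP; rewrite eqr_nat => /eqP.
Qed.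
Lemma xpB n (k l : nat) : (l <= k)%N -> xp n k - xp n l = xp n (k - l)%N.
Proof. by move=> h; rewrite -mulrBl natrB. Qed.
Lemma xp_up n m k : (n <= m)%N -> xp n k = xp m (k * p ^ (m - n))%N.
Proof.
move=> h; rewrite natrM natrX -{2}(subnK h) exprD invfM.
by rewrite mulrA mulfK // q_neq0.
Qed.

Definition lev n N f :=
  forall i, i < N%:R -> f i != 0 -> exists k : nat, i = xp n k.

Lemma lev_up n m N f : (n <= m)%N -> lev n N f -> lev m N f.
Proof.
move=> h L i iN fi; have [k ->] := L i iN fi.
by exists (k * p ^ (m - n))%N; apply: xp_up.
Qed.

Lemma EtildeP u v : u =1 v -> u = v.
Proof.
case: u v => [a Ha] [b Hb] /= /funext e; subst b.
by congr MkEtilde; apply: Prop_irrelevance.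
Qed.

Lemma lev_ex u N : exists n, lev n N u.
Proof.
have [n [f [Lf e]]] := coefEP u N; exists n => i iN ui; apply: Lf.
by rewrite -e.
Qed.

Lemma lev_closure f : (forall N, exists n, lev n N f) ->
  forall N : nat, exists n g, in_level n g /\ forall i, i < N%:R -> f i = g i.
Proof.
move=> H N; have [n L] := H N.
exists n, (fun i => if i < N%:R then f i else 0); split; last by move=> i ->.
by move=> i; case: ifP => [iN|]; [apply: L | rewrite eqxx].
Qed.
Definition mkE f (H : forall N, exists n, lev n N f) : E :=
  MkEtilde p_pr (lev_closure H).

Lemma lev_ex2 u v N : exists n, lev n N u /\ lev n N v.
Proof.
have [n Ln] := lev_ex u N; have [m Lm] := lev_ex v N.
by exists (maxn n m); split; [apply: lev_up Ln | apply: lev_up Lm];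
  rewrite ?leq_maxl ?leq_maxr.
Qed.

Lemma rat_ltn (i : rat) : exists N : nat, i < N%:R.
Proof.
exists (Num.bound `|i|); apply: le_lt_trans (ler_norm i) _.
by apply: archi_boundP; apply: normr_ge0.
Qed.

Lemma coef_lt0 u i : i < 0 -> u i = 0.
Proof.
move=> i0; apply/eqP; apply: contraTT i0 => ui.
have [n L] := lev_ex u 0; rewrite -leNgt; case: (leP 0 i) => // i0.
have [k ik] := L i i0 ui; move: i0; rewrite ik.
by rewrite ltNge divr_ge0 ?ler0n // ltW ?q_gt0.
Qed.

HB.instance Definition _ := gen_eqMixin E.
HB.instance Definition _ := gen_choiceMixin E.

Fact zeroE_sub N : exists n, lev n N (fun _ => 0).
Proof. by exists 0%N => i _; rewrite eqxx. Qed.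
Definition zeroE : E := mkE zeroE_sub.

Fact addE_sub u v N : exists n, lev n N (fun i => u i + v i).
Proof.
have [n [Lu Lv]] := lev_ex2 u v N; exists n => i iN.
case: (eqVneq (u i) 0) => [->|ui _]; last exact: Lu.
by rewrite add0r; apply: Lv.
Qed.
Definition addE u v : E := mkE (addE_sub u v).

Fact oppE_sub u N : exists n, lev n N (fun i => - u i).
Proof.
by have [n Lu] := lev_ex u N; exists n => i iN; rewrite oppr_eq0; apply: Lu.
Qed.
Definition oppE u : E := mkE (oppE_sub u).

Fact addE_A : associative addE.
Proof. by move=> u v w; apply: EtildeP => i /=; rewrite addrA. Qed.
Fact addE_C : commutative addE.
Proof. by move=> u v; apply: EtildeP => i /=; rewrite addrC. Qed.
Fact addE_0 : left_id zeroE addE.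
Proof. by move=> u; apply: EtildeP => i /=; rewrite add0r. Qed.
Fact addE_N : left_inverse zeroE oppE addE.
Proof. by move=> u; apply: EtildeP => i /=; rewrite addNr. Qed.
HB.instance Definition _ :=
  GRing.isZmodule.Build E addE_A addE_C addE_0 addE_N.

Fact scaleE_sub c u N : exists n, lev n N (fun i => c * u i).
Proof.
have [n Lu] := lev_ex u N; exists n => i iN.
by rewrite mulf_eq0 negb_or => /andP [_]; apply: Lu.
Qed.
Definition scaleE c u : E := mkE (scaleE_sub c u).

Fact scaleE_A a b u : scaleE a (scaleE b u) = scaleE (a * b) u.
Proof. by apply: EtildeP => i /=; rewrite mulrA. Qed.
Fact scaleE_1 : left_id 1 scaleE.
Proof. by move=> u; apply: EtildeP => i /=; rewrite mul1r. Qed.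
Fact scaleE_Dr : right_distributive scaleE +%R.
Proof. by move=> a u v; apply: EtildeP => i /=; rewrite mulrDr. Qed.
Fact scaleE_Dl u : {morph scaleE^~ u : a b / a + b}.
Proof. by move=> a b; apply: EtildeP => i /=; rewrite mulrDl. Qed.
HB.instance Definition _ := GRing.Zmodule_isLmodule.Build 'F_p E
  scaleE_A scaleE_1 scaleE_Dr scaleE_Dl.

Fact monoE_sub (c : 'F_p) n k N :
  exists m, lev m N (fun i => if i == xp n k then c else 0).
Proof. exists n => i _; case: (eqVneq i (xp n k)) => [->|]; first by exists k.
by rewrite eqxx. Qed.
Fact monoE_key : unit. Proof. exact: tt. Qed.
(* [c X^(k/p^n)] *)
Definition monoE (c : 'F_p) n k : E :=
  locked_with monoE_key (mkE (monoE_sub c n k)).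
Lemma coef_mono c n k i : monoE c n k i = if i == xp n k then c else 0.
Proof. by rewrite /monoE unlock. Qed.

(* The sum has finite support because [u] and [v] do below each exponent. *)
Definition convE f g (i : rat) : 'F_p := \sum_(j \in setT) f j * g (i - j).

Lemma convE_neq0 u v i : convE u v i != 0 ->
  exists j, [/\ u j != 0, v (i - j) != 0, 0 <= j & j <= i].
Proof.
move=> H; have [j] : exists j, u j * v (i - j) != 0.
  apply: contrapT => /forallNP h; move/eqP: H; apply; apply: fsbig1 => j _.
  by apply/eqP/negPn/negP/h.
rewrite mulf_eq0 negb_or => /andP [uj vj]; exists j; split => //.
  by rewrite leNgt; apply: contraNN uj => /coef_lt0 ->.
by rewrite -subr_ge0 leNgt; apply: contraNN vj => /coef_lt0 ->.
Qed.

Lemma convE_lev u v n N : lev n N u -> lev n N v -> lev n N (convE u v).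
Proof.
move=> Lu Lv i iN /convE_neq0 [j [uj vj j0 ji]].
have [|k jk] := Lu j _ uj; first exact: le_lt_trans iN.
have [|l il] := Lv (i - j) _ vj; first by apply: le_lt_trans iN; rewrite gerBl.
by exists (l + k)%N; rewrite natrD mulrDl -il -jk subrK.
Qed.

Lemma convE_xp u v n N k : lev n N u -> xp n k < N%:R ->
  convE u v (xp n k) = \sum_(j < k.+1) u (xp n j) * v (xp n (k - j)%N).
Proof.
move=> Lu kN; rewrite /convE.
rewrite (fsbigE [seq xp n j | j <- iota 0 k.+1]); first last.
- move=> j _; apply: contraNeq; rewrite mulf_eq0 negb_or => /andP [uj vj].
  have jk : j <= xp n k.
    by rewrite -subr_ge0 leNgt; apply: contraNN vj => /coef_lt0 ->.
  have [|l jl] := Lu j _ uj; first exact: le_lt_trans kN.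
  apply/mapP; exists l => //; rewrite mem_iota /= add0n.
  by move: jk; rewrite jl leNgt xp_lt -leqNgt ltnS.
- by [].
- by rewrite map_inj_uniq ?iota_uniq //; apply: xp_inj.
rewrite big_map -[iota _ _]/(index_iota 0 k.+1) big_mkord.
by apply: eq_big => [j|j _]; [rewrite in_setT | rewrite xpB // -ltnS].
Qed.

Fact mulE_sub u v N : exists n, lev n N (convE u v).
Proof.
by have [n [Lu Lv]] := lev_ex2 u v N; exists n; apply: convE_lev.
Qed.
Fact mulE_key : unit. Proof. exact: tt. Qed.
Definition mulE u v : E := locked_with mulE_key (mkE (mulE_sub u v)).
Lemma coef_mulE u v : mulE u v = convE u v :> (rat -> 'F_p).
Proof. by rewrite /mulE unlock. Qed.

(* Identities between products are checked below each exponent on the level-n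
   polynomials in X^(1/p^n). *)
Definition polE n K f : {poly 'F_p} := \poly_(k < K) f (xp n k).

Lemma mulE_pol u v n N k : lev n N u -> (k < N * p ^ n)%N ->
  mulE u v (xp n k) = (polE n (N * p ^ n) u * polE n (N * p ^ n) v)`_k.
Proof.
move=> Lu kN; rewrite coef_mulE (@convE_xp _ _ n N) // ?xp_ltN // coefM.
apply: eq_bigr => j _; rewrite !coef_poly.
by rewrite (leq_ltn_trans _ kN) 1?(leq_ltn_trans _ kN) ?leq_subr // -ltnS.
Qed.

Lemma E_eq u v : (forall N, exists n, [/\ lev n N u, lev n N v &
    forall k, (k < N * p ^ n)%N -> u (xp n k) = v (xp n k)]) -> u = v.
Proof.
move=> H; apply: EtildeP => i; have [N iN] := rat_ltn i.
have [n [Lu Lv e]] := H N.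
case: (eqVneq (u i) 0) => [ui|/(Lu i iN) [k ik]]; last first.
  by rewrite ik; apply: e; rewrite -xp_ltN -ik.
case: (eqVneq (v i) 0) => [-> //|/(Lv i iN) [k ik]].
by rewrite ik; apply: e; rewrite -xp_ltN -ik.
Qed.

Lemma coefM_eq (A A' B B' : {poly 'F_p}) k :
  (forall j, (j <= k)%N -> A`_j = A'`_j) ->
  (forall j, (j <= k)%N -> B`_j = B'`_j) -> (A * B)`_k = (A' * B')`_k.
Proof.
move=> hA hB; rewrite !coefM; apply: eq_bigr => j _.
by rewrite hA ?hB ?leq_subr // -ltnS.
Qed.

Lemma polE_mul u v n N j : lev n N u -> (j < N * p ^ n)%N ->
  (polE n (N * p ^ n) (mulE u v))`_j =
  (polE n (N * p ^ n) u * polE n (N * p ^ n) v)`_j.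
Proof. by move=> Lu jN; rewrite coef_poly jN (mulE_pol v Lu jN). Qed.

Fact mulE_C : commutative mulE.
Proof.
move=> u v; apply: E_eq => N; have [n [Lu Lv]] := lev_ex2 u v N.
exists n; split; try by rewrite coef_mulE; apply: convE_lev.
by move=> k kN; rewrite !(@mulE_pol _ _ n N) // mulrC.
Qed.

Fact mulE_A : associative mulE.
Proof.
move=> u v w; apply: E_eq => N.
have [n0 [Lu Lv]] := lev_ex2 u v N; have [n1 Lw] := lev_ex w N.
have [h0 h1] := (leq_maxl n0 n1, leq_maxr n0 n1).
move: (lev_up h0 Lu) (lev_up h0 Lv) (lev_up h1 Lw) => {Lu Lv Lw h0 h1}.
move: (maxn n0 n1) => n {n0 n1} Lu Lv Lw.
have Luv : lev n N (mulE u v) by rewrite coef_mulE; apply: convE_lev.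
have Lvw : lev n N (mulE v w) by rewrite coef_mulE; apply: convE_lev.
exists n; split; try by rewrite coef_mulE; apply: convE_lev.
move=> k kN; rewrite !(@mulE_pol _ _ n N) //.
rewrite -[LHS](@coefM_eq (polE n (N * p ^ n) u) _
  (polE n (N * p ^ n) v * polE n (N * p ^ n) w)) //; last first.
  by move=> j jk; rewrite polE_mul // (leq_ltn_trans jk).
rewrite mulrA; apply: coefM_eq => // j jk.
by rewrite polE_mul // (leq_ltn_trans jk).
Qed.

Definition oneE : E := monoE 1 0 0.

Fact mulE_1 : left_id oneE mulE.
Proof.
move=> u; apply: EtildeP => i; rewrite coef_mulE /convE.
rewrite (fsbigE [:: 0]) //=; last first.
  move=> j _; rewrite inE coef_mono mul0r => /negbTE ->.
  by rewrite mul0r.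
by rewrite big_mkcond big_seq1 in_setT coef_mono mul0r eqxx mul1r subr0.
Qed.

Fact mulE_D : left_distributive mulE +%R.
Proof.
move=> u v w; apply: E_eq => N.
have [n0 [Lu Lv]] := lev_ex2 u v N; have [n1 Lw] := lev_ex w N.
have [h0 h1] := (leq_maxl n0 n1, leq_maxr n0 n1).
move: (lev_up h0 Lu) (lev_up h0 Lv) (lev_up h1 Lw) => {Lu Lv Lw h0 h1}.
move: (maxn n0 n1) => n {n0 n1} Lu Lv Lw.
have LD f g : lev n N f -> lev n N g -> lev n N (fun i => f i + g i).
  move=> Lf Lg i iN; case: (eqVneq (f i) 0) => [->|fi _]; last exact: Lf.
  by rewrite add0r; apply: Lg.
have Luv : lev n N (u + v) by apply: LD.
exists n; split; first by rewrite coef_mulE; apply: convE_lev.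
  by apply: LD; rewrite coef_mulE; apply: convE_lev.
move=> k kN; rewrite [RHS]/=.
rewrite !(@mulE_pol _ _ n N) // -coefD -mulrDl.
congr ((polyseq (_ * _))`_k); apply/polyP => j; rewrite coefD !coef_poly.
by case: ifP => //; rewrite addr0.
Qed.

Fact oneE_neq0 : oneE != 0.
Proof.
apply/eqP => /(congr1 (fun u : E => u (xp 0 0))).
rewrite coef_mono eqxx /=.
by move/eqP; rewrite oner_eq0.
Qed.

HB.instance Definition _ := GRing.Zmodule_isComNzRing.Build E
  mulE_A mulE_C mulE_1 mulE_D oneE_neq0.

Fact scaleE_Al (c : 'F_p) u v : c *: (u * v) = c *: u * v.
Proof.
apply: E_eq => N; have [n [Lu Lv]] := lev_ex2 u v N.
have LZ f : lev n N f -> lev n N (fun i => c * f i).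
  by move=> Lf i iN; rewrite mulf_eq0 negb_or => /andP [_]; apply: Lf.
have Lcu : lev n N (c *: u) by apply: LZ.
have LM u' v' : lev n N u' -> lev n N v' -> lev n N (u' * v').
  by move=> Lu' Lv'; rewrite coef_mulE; apply: convE_lev.
exists n; split; [by apply: LZ; apply: LM | exact: LM |].
move=> k kN; rewrite [LHS]/= -[u * v]/(mulE u v) -[_ * v]/(mulE _ v).
rewrite !(@mulE_pol _ _ n N) // -coefZ scalerAl.
congr ((polyseq (_ * _))`_k); apply/polyP => j; rewrite coefZ !coef_poly.
by case: ifP => //; rewrite mulr0.
Qed.
HB.instance Definition _ := GRing.Lmodule_isLalgebra.Build 'F_p E scaleE_Al.
HB.instance Definition _ := GRing.Lalgebra_isComAlgebra.Build 'F_p E.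

Lemma coefE0 i : (0 : E) i = 0. Proof. by []. Qed.
Lemma coefED u v i : (u + v) i = u i + v i. Proof. by []. Qed.
Lemma coefEN u i : (- u) i = - u i. Proof. by []. Qed.
Lemma coefEB u v i : (u - v) i = u i - v i. Proof. by []. Qed.
Lemma coefEZ c u i : (c *: u) i = c * u i. Proof. by []. Qed.
Lemma coefEM u v i : (u * v) i = \sum_(j \in setT) u j * v (i - j).
Proof. by rewrite -[u * v]/(mulE u v) coef_mulE. Qed.
Lemma coefEsum I (r : seq I) (P : pred I) (F : I -> E) i :
  (\sum_(k <- r | P k) F k) i = \sum_(k <- r | P k) F k i.
Proof. by elim/big_rec2: _ => // k x y _ <-. Qed.

End EtildeRing.

Section EtildeTop.
Variables (p : nat) (p_pr : prime p).
Local Notation E := (Etilde p_pr).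
Local Notation Zp := (padic p_pr).
Implicit Types (u v w x y : E) (a b : Zp) (r s : rat) (P Q : {poly 'F_p}).

Local Notation q n := (p%:R ^+ n : rat).
Local Notation xp n k := (k%:R / q n).

Definition is_order u (i : rat) : Prop :=
  u i != 0 /\ forall j, j < i -> u j = 0.

Definition valX u : \bar rat :=
  if pselect (exists i, is_order u i) is left h then (sval (cid h))%:E
  else +oo%E.

Lemma order_ex u : u != 0 -> exists i, is_order u i.
Proof.
move=> u0; have [i ui] : exists i, u i != 0.
  apply: contrapT => /forallNP h; move/eqP: u0; apply; apply: EtildeP => i.
  exact/eqP/negPn/negP/h.
have [N iN] := rat_ltn i; have [n L] := lev_ex u N.
have [k ik] := L i iN ui; rewrite {}ik in iN ui.
have ex : exists k, u (xp n k) != 0 by exists k.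
case: (ex_minnP ex) => m um min_m; exists (xp n m); split=> // j jm.
apply/eqP; apply: contraTT jm => uj.
have [kj|jk] := leP (xp n k) j.
  by rewrite -leNgt (le_trans _ kj) // leNgt xp_lt // -leqNgt min_m.
have [l jl] := L j (lt_trans jk iN) uj; rewrite jl xp_lt // -leqNgt.
by apply: min_m; rewrite -jl.
Qed.

Lemma valX0 : valX 0 = +oo%E.
Proof. by rewrite /valX; case: pselect => // h; exfalso; case: h => i [/eqP]. Qed.

Lemma valXP u i : valX u = i%:E <-> is_order u i.
Proof.
rewrite /valX; case: pselect => [h|h]; last by split => // H; case: h; exists i.
case: cid => j [uj hj] /=; split => [[<-] //|[ui hi]].
congr (_ %:E)%E; apply/eqP; rewrite eq_le !leNgt; apply/andP; split.
  by apply: contraNN ui => /hj ->.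
by apply: contraNN uj => /hi ->.
Qed.

Definition eqX r u v := forall i, i < r -> u i = v i.

Lemma valX_ge r u : (r%:E <= valX u)%E <-> eqX r u 0.
Proof.
case: (eqVneq u 0) => [->|/order_ex [i ui]]; first by rewrite valX0 leey.
rewrite (proj2 (valXP u i) ui) lee_fin; case: ui => ui hi; split.
  by move=> ri j jr; apply: hi; apply: lt_le_trans ri.
by move=> h; rewrite leNgt; apply: contraNN ui => /h ->.
Qed.

Lemma valX_ge_sub r u v : (r%:E <= valX (u - v)%R)%E <-> eqX r u v.
Proof.
rewrite valX_ge; split => h i ir; last by rewrite coefEB h // subrr.
by apply/eqP; rewrite -subr_eq0 -coefEB h.
Qed.

Lemma valX_gt0 u : (0 < valX u)%E <-> exists2 r : rat, 0 < r & eqX r u 0.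
Proof.
split=> [|[r r0 /valX_ge h]]; last by apply: lt_le_trans h; rewrite lte_fin.
case: (eqVneq u 0) => [->|/order_ex [i ui]]; first by exists 1.
rewrite (proj2 (valXP u i) ui) lte_fin => i0; exists i => //.
by case: ui.
Qed.

Lemma eqX_refl r u : eqX r u u. Proof. by []. Qed.
Lemma eqX_sym r u v : eqX r u v -> eqX r v u.
Proof. by move=> h i /h ->. Qed.
Lemma eqX_trans r v u w : eqX r u v -> eqX r v w -> eqX r u w.
Proof. by move=> h1 h2 i ir; rewrite h1 // h2. Qed.
Lemma eqX_le s r u v : r <= s -> eqX s u v -> eqX r u v.
Proof. by move=> rs h i ir; apply: h; apply: lt_le_trans rs. Qed.
Lemma eqX_D r u v u' v' : eqX r u u' -> eqX r v v' -> eqX r (u + v) (u' + v').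
Proof. by move=> h1 h2 i ir; rewrite !coefED h1 // h2. Qed.
Lemma eqX_N r u u' : eqX r u u' -> eqX r (- u) (- u').
Proof. by move=> h1 i ir; rewrite !coefEN h1. Qed.
Lemma eqX_Z r c u u' : eqX r u u' -> eqX r (c *: u) (c *: u').
Proof. by move=> h1 i ir; rewrite !coefEZ h1. Qed.
Lemma eqX_M0 r s u v : eqX r u 0 -> eqX s v 0 -> eqX (r + s) (u * v) 0.
Proof.
move=> hu hv i irs; apply/eqP; apply: contraTT irs.
rewrite coefEM => /convE_neq0 [j [uj vj _ _]]; rewrite -leNgt -(subrK j i) addrC.
by apply: lerD; rewrite leNgt; [apply: contraNN vj => /hv -> |
  apply: contraNN uj => /hu ->].
Qed.
Lemma eqX_00 u : eqX 0 u 0. Proof. by move=> i /coef_lt0 ->. Qed.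
Lemma eqX_sub r u v : eqX r u v <-> eqX r (u - v) 0.
Proof. by rewrite -valX_ge -valX_ge_sub. Qed.
Lemma eqX_M r u v u' v' : eqX r u u' -> eqX r v v' -> eqX r (u * v) (u' * v').
Proof.
move=> /eqX_sub h1 /eqX_sub h2; apply/eqX_sub.
have -> : u * v - u' * v' = (u - u') * v + u' * (v - v').
  by rewrite mulrBl mulrBr addrA subrK.
rewrite -[0]addr0; apply: eqX_D.
  by rewrite -[r]addr0; apply: eqX_M0 => //; apply: eqX_00.
by rewrite -[r]add0r; apply: eqX_M0 => //; apply: eqX_00.
Qed.
Lemma eqX_X r u v k : eqX r u v -> eqX r (u ^+ k) (v ^+ k).
Proof. by move=> h; elim: k => [//|k IH]; rewrite !exprS; apply: eqX_M. Qed.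
Lemma eqX_sum r I (l : seq I) (R : pred I) (F G : I -> E) :
  (forall k, R k -> eqX r (F k) (G k)) ->
  eqX r (\sum_(k <- l | R k) F k) (\sum_(k <- l | R k) G k).
Proof. by move=> h; elim/big_ind2: _ => // *; apply: eqX_D. Qed.
Lemma eqX_sum0 r I (l : seq I) (R : pred I) (F : I -> E) :
  (forall k, R k -> eqX r (F k) 0) -> eqX r (\sum_(k <- l | R k) F k) 0.
Proof.
move=> h; elim/big_ind: _ => // u v hu hv.
by rewrite -[0]addr0; apply: eqX_D.
Qed.
Lemma eqX_X0 r u k : eqX r u 0 -> eqX (k%:R * r) (u ^+ k) 0.
Proof.
move=> h; elim: k => [|k IH]; first by rewrite mul0r; apply: eqX_00.
by rewrite exprS -natr1 mulrDl mul1r addrC; apply: eqX_M0.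
Qed.
Lemma eqX_eq u v : (forall N : nat, eqX N%:R u v) -> u = v.
Proof.
by move=> h; apply: EtildeP => i; have [N iN] := rat_ltn i; apply: h iN.
Qed.

Definition cvgX (s : nat -> E) (l : E) : Prop :=
  forall N : nat, exists M : nat, forall m,
    (M <= m)%N -> (N%:R%:E <= valX (s m - l)%R)%E.
Definition cauchyX (s : nat -> E) : Prop :=
  forall N : nat, exists M : nat, forall m n,
    (M <= m)%N -> (M <= n)%N -> (N%:R%:E <= valX (s m - s n)%R)%E.
Definition limX (s : nat -> E) : E := xget 0 [set l | cvgX s l].

Lemma Etilde_complete (s : nat -> E) : cauchyX s -> exists l, cvgX s l.
Proof.
move=> /choice [M HM].
have {}HM N m n : (M N <= m)%N -> (M N <= n)%N -> eqX N%:R (s m) (s n).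
  by move=> h1 h2; apply/valX_ge_sub/HM.
have bd (i : rat) : i < (Num.bound `|i|)%:R.
  apply: le_lt_trans (ler_norm i) _.
  by apply: archi_boundP; apply: normr_ge0.
pose f (i : rat) := s (M (Num.bound `|i|)) i.
have fE N m i : (M N <= m)%N -> i < N%:R -> f i = s m i.
  move=> Mm iN; rewrite /f.
  rewrite (HM (Num.bound `|i|) _ (maxn m (M (Num.bound `|i|)))) ?leq_maxr //.
  by apply/esym/(HM N) => //; rewrite leq_max Mm.
have H N : exists n, lev n N f.
  have [n L] := lev_ex (s (M N)) N; exists n => i iN.
  by rewrite (fE N (M N)) //; apply: L.
exists (mkE p_pr H) => N; exists (M N) => m Mm; apply/valX_ge_sub => i iN.
by rewrite /= (fE N m).
Qed.

Lemma cvgX_unique (s : nat -> E) l l' : cvgX s l -> cvgX s l' -> l = l'.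
Proof.
move=> h h'; apply: eqX_eq => N; have [M HM] := h N; have [M' HM'] := h' N.
have /valX_ge_sub /eqX_sym e := HM (maxn M M') (leq_maxl _ _).
have /valX_ge_sub e' := HM' (maxn M M') (leq_maxr _ _).
exact: eqX_trans e'.
Qed.

Lemma limXP (s : nat -> E) : cauchyX s -> cvgX s (limX s).
Proof.
move=> /Etilde_complete [l sl].
by apply: (xgetPex 0 (P := [set l | cvgX s l])); exists l.
Qed.

Lemma limX_eq (s : nat -> E) l : cvgX s l -> limX s = l.
Proof.
move=> sl; apply: cvgX_unique (sl).
apply: (xgetPex 0 (P := [set l | cvgX s l])).
by exists l.
Qed.

Lemma Etilde_dense u (N : nat) :
  exists n v, in_level n v /\ (N%:R%:E <= valX (u - v)%R)%E.
Proof.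
have [n [f [Lf e]]] := coefEP u N.
have H M : exists m, lev m M f by exists n => i _; apply: Lf.
by exists n, (mkE p_pr H); split => //; apply/valX_ge_sub.
Qed.

Definition rootX n : E := monoE p_pr 1 n 1.
Definition varX : E := rootX 0.

Lemma mono_mul c n k u i : (monoE p_pr c n k * u) i = c * u (i - xp n k).
Proof.
rewrite coefEM (fsbigE [:: xp n k]) //=; last first.
  by move=> j _; rewrite inE coef_mono => /negbTE ->; rewrite mul0r.
by rewrite big_mkcond big_seq1 in_setT coef_mono eqxx.
Qed.

Lemma rootX_exp n k : rootX n ^+ k = monoE p_pr 1 n k.
Proof.
elim: k => [|k IH].
  by rewrite expr0; apply: EtildeP => i; rewrite !coef_mono !mul0r.
apply: EtildeP => i; rewrite exprS IH mono_mul mul1r !coef_mono.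
by rewrite subr_eq -mulrDl natr1.
Qed.

Lemma rootX_root n m : rootX n = rootX (m + n) ^+ (p ^ m).
Proof.
rewrite rootX_exp; apply: EtildeP => i; rewrite !coef_mono; congr (if i == _ then _ else _).
by rewrite exprD natrX invfM mulrA divff ?q_neq0 // ?mul1r.
Qed.

Lemma rootX_ge n : eqX (q n)^-1 (rootX n) 0.
Proof. by move=> i h; rewrite coef_mono mul1r; case: eqP h => // ->; rewrite ltxx. Qed.

Lemma valX_varX : valX varX = 1%:E.
Proof.
have e : xp 0 1%N = 1 by rewrite expr0 divr1.
apply/valXP; split => [|j jl]; rewrite coef_mono e.
  by rewrite eqxx oner_neq0.
by rewrite lt_eqF.
Qed.

(* The X-adic topology is the valuation topology, both on [Etilde] and on the
   union of the F_p[[X^(1/p^n)]]. *)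
Lemma valX_ge_divX u (N : nat) :
  (N%:R%:E <= valX u)%E <-> exists v, u = varX ^+ N * v.
Proof.
rewrite valX_ge rootX_exp; split => [h|[v ->] i iN]; last first.
  by rewrite mono_mul mul1r divr1 coef_lt0 // subr_lt0.
have H M : exists n, lev n M (fun i => u (i + N%:R)).
  have [n L] := lev_ex u (M + N); exists n => i iM ui.
  have [|k ik] := L (i + N%:R) _ ui; first by rewrite natrD ltrD2r.
  have Nk : (N * p ^ n <= k)%N.
    rewrite leqNgt -(xp_ltN p_pr) -ik; apply: contraNN ui.
    by move=> /h ->.
  exists (k - N * p ^ n)%N; rewrite -xpB // -ik natrM natrX.
  by rewrite mulfK ?q_neq0 // addrK.
exists (mkE p_pr H); apply: EtildeP => i.
by rewrite mono_mul mul1r divr1 /= subrK.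
Qed.

Lemma in_level_divX n N v : in_level n (varX ^+ N * v) -> in_level n v.
Proof.
move=> h i vi; have [|k ik] := h (i + N%:R).
  by rewrite rootX_exp mono_mul divr1 mul1r addrK.
have i0 : 0 <= i by rewrite leNgt; apply: contraNN vi => /coef_lt0 ->.
have Nk : (N * p ^ n <= k)%N.
  by rewrite leqNgt -(xp_ltN p_pr) -ik -leNgt lerDr.
exists (k - N * p ^ n)%N; rewrite -xpB // -ik natrM natrX.
by rewrite mulfK ?q_neq0 // addrK.
Qed.

(* [X^(p^n)] *)
Definition Xpow_p (n : int) : E :=
  match n with Posz m => varX ^+ (p ^ m) | Negz m => rootX m.+1 end.

(* Z_p acts on [Etilde] through its residue field F_p. *)
Definition gamma_psum a u (m : nat) : E :=
  \sum_(1 <= n < m) padic_red (padic_bin a n) *: u ^+ n.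

End EtildeTop.

(* [(1 + u)^a - 1]; meaningful when [0 < valX u], see [gamma_comp_cvg].  It is
   sealed to keep unification from unfolding it, [gamma_compE] unseals it. *)
HB.lock Definition gamma_comp (p : nat) (p_pr : prime p) (a : padic p_pr)
  (u : Etilde p_pr) : Etilde p_pr := limX (gamma_psum a u).

Section Gamma.
Variables (p : nat) (p_pr : prime p).
Local Notation E := (Etilde p_pr).
Local Notation Zp := (padic p_pr).
Implicit Types (u v w x y : E) (a b : Zp) (r s : rat) (P Q : {poly 'F_p}).

Local Notation q n := (p%:R ^+ n : rat).
Local Notation xp n k := (k%:R / q n).

Lemma gamma_compE a u : gamma_comp a u = limX (gamma_psum a u).
Proof. by rewrite unlock. Qed.

Lemma gamma_comp_cvg a u : (0 < valX u)%E ->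
  cvgX (gamma_psum a u) (gamma_comp a u).
Proof.
move=> /valX_gt0 [r r0 ur]; rewrite gamma_compE; apply: limXP => N.
exists (Num.bound `|N%:R / r|).+1 => m n.
set M := _.+1.
have hM k : (M <= k)%N -> eqX N%:R (u ^+ k) 0.
  move=> Mk; apply: (@eqX_le _ _ (k%:R * r)); last exact: eqX_X0.
  rewrite -ler_pdivrMr //; apply: le_trans (ler_norm _) _.
  apply/ltW/(lt_le_trans (archi_boundP (normr_ge0 _))).
  by rewrite ler_nat (leq_trans _ Mk).
have hs k : (M <= k)%N -> eqX N%:R (gamma_psum a u k) (gamma_psum a u M).
  move=> Mk; rewrite /gamma_psum (big_cat_nat (n := M)) //=.
  rewrite -[X in eqX _ _ X]addr0; apply: eqX_D => //.
  rewrite big_nat; apply: eqX_sum0 => j /andP [Mj _].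
  rewrite -(scaler0 _ (padic_red (padic_bin a j))).
  by apply/eqX_Z/hM.
move=> Mm Mn; apply/valX_ge_sub; apply: eqX_trans (hs m Mm) _.
exact/eqX_sym/hs.
Qed.

Definition continuousX (s : E -> E) : Prop :=
  forall u (N : nat), exists M : nat, forall v,
    (M%:R%:E <= valX (v - u)%R)%E -> (N%:R%:E <= valX (s v - s u)%R)%E.

(* [s] is the automorphism by which [a] acts, see [cyclo_aut_unique]. *)
Definition is_cyclo_aut a (s : E -> E) : Prop :=
  [/\ GRing.zmod_morphism s, GRing.monoid_morphism s, bijective s,
      continuousX s & forall n, s (rootX p_pr n) = gamma_comp a (rootX p_pr n)].

End Gamma.

Section CycloAction.
Variables (p : nat) (p_pr : prime p).
Local Notation E := (Etilde p_pr).
Local Notation Zp := (padic p_pr).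
Implicit Types (u v w x y : E) (a b : Zp) (r s : rat) (P Q : {poly 'F_p}).

Local Notation q n := (p%:R ^+ n : rat).
Local Notation xp n k := (k%:R / q n).

Lemma frobD (R : comNzRingType) (x y : R) k : p \in [pchar R] ->
  (x + y) ^+ (p ^ k) = x ^+ (p ^ k) + y ^+ (p ^ k).
Proof.
move=> pR; apply: exprDn_pchar; apply: (@sub_in_pnat p).
  by move=> l _; rewrite !inE => /eqP ->.
by rewrite pnatX pnat_id ?orTb.
Qed.

Lemma pcharE : p \in [pchar E].
Proof. by rewrite pchar_lalg pchar_Fp. Qed.

Lemma coef_1DXn n k : ((1 + 'X) ^+ n : {poly 'F_p})`_k = 'C(n, k)%:R.
Proof.
rewrite addrC exprD1n coef_sum.
case: (ltnP k n.+1) => h; last first.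
  rewrite bin_small // big1 // => i _; rewrite coefMn coefXn.
  by rewrite gtn_eqF ?mul0rn // (leq_trans _ h).
rewrite (bigD1 (Ordinal h)) //= coefMn coefXn eqxx big1 ?addr0 // => i.
rewrite -val_eqE /= => ik; rewrite coefMn coefXn eq_sym (negbTE ik).
by rewrite mul0rn.
Qed.

Lemma bin_lucas m l n k : (m = l %[mod p ^ k])%N -> (n < p ^ k)%N ->
  'C(m, n)%:R = 'C(l, n)%:R :> 'F_p.
Proof.
wlog lm : m l / (l <= m)%N.
  move=> W; case: (leqP l m) => [|/ltnW] le h; first exact: W.
  by move=> nk; apply/esym/W.
move/eqP; rewrite eqn_mod_dvd // => /dvdnP [c Ec] nk.
have -> : m = (p ^ k * c + l)%N by rewrite mulnC -Ec subnK.
rewrite -!coef_1DXn exprD exprM frobD; last by rewrite pchar_poly pchar_Fp.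
rewrite expr1n mulrC.
have [T ->] : exists T : {poly 'F_p}, (1 + 'X ^+ (p ^ k)) ^+ c = 1 + 'X ^+ (p ^ k) * T.
  elim: c {Ec} => [|c [T e]]; first by exists 0; rewrite mulr0 addr0.
  by rewrite exprS e; exists (T + 1 + 'X ^+ (p ^ k) * T); ring.
by rewrite mulrDr mulr1 coefD mulrCA coefXnM nk addr0.
Qed.

Lemma red_bin a n k : (n < p ^ k)%N ->
  padic_red (padic_bin a n) = 'C(a k, n)%:R :> 'F_p.
Proof.
move=> nk; rewrite /padic_red /= expn1 Fp_nat_mod //.
set v := logn p n`!; case: (leqP k (1 + v)%N) => h.
  by apply: bin_lucas nk; rewrite pres_id pres_mod.
rewrite -[LHS]Fp_nat_mod // -[RHS]Fp_nat_mod // -[X in (_ %% X)%N]expn1.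
rewrite -[X in _ = (_ %% X)%:R]expn1; congr (_%:R); apply/esym.
apply: (bin_congr p_pr); rewrite -/v.
by rewrite pres_id pres_mod // ltnW.
Qed.

Lemma gamma_pow a x r k : 0 < r -> eqX r x 0 ->
  eqX ((p ^ k)%:R * r) (1 + gamma_comp a x) ((1 + x) ^+ a k).
Proof.
move=> r0 xr; have [N hN] := rat_ltn ((p ^ k)%:R * r).
have x0 : (0 < valX x)%E by apply/valX_gt0; exists r.
have [M /(_ (maxn M (p ^ k)) (leq_maxl _ _))] := gamma_comp_cvg a x0 N.
move=> /valX_ge_sub /(eqX_le (ltW hN)) /eqX_sym h.
apply: (@eqX_trans _ _ _ (1 + gamma_psum a x (maxn M (p ^ k)))).
  by apply: eqX_D.
clear h.
set m := maxn _ _; have pm : (p ^ k <= m)%N by apply: leq_maxr.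
have pk : (0 < p ^ k)%N by rewrite expn_gt0 prime_gt0.
rewrite /gamma_psum (big_cat_nat (n := (p ^ k)%N)) // addrA -[X in eqX _ _ X]addr0.
apply: eqX_D; last first.
  rewrite big_nat; apply: eqX_sum0 => j /andP [Mj _].
  rewrite -(scaler0 _ (padic_red (padic_bin a j))); apply: eqX_Z.
  apply: (@eqX_le _ _ (j%:R * r)); last exact: eqX_X0.
  by rewrite ler_pM2r // ler_nat.
have ak : (a k < p ^ k)%N by rewrite -(pres_id a k) ltn_pmod.
suff -> : (1 + x) ^+ a k = \sum_(0 <= n < p ^ k) 'C(a k, n)%:R *: x ^+ n.
  rewrite [X in eqX _ _ X]big_ltn // bin0 scale1r expr0.
  apply: eqX_D => //; rewrite big_nat [X in eqX _ _ X]big_nat.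
  by apply: eqX_sum => j /andP [_ jk]; rewrite (red_bin a jk).
rewrite (big_cat_nat (n := (a k).+1)) // [X in _ = _ + X]big_nat.
rewrite [X in _ = _ + X]big1 ?addr0 => [|j /andP [jk _]]; last first.
  by rewrite bin_small // scale0r.
rewrite big_mkord addrC exprD1n; apply: eq_bigr => j _.
by rewrite scaler_nat.
Qed.

Lemma eqX_pk r u v : 0 < r ->
  (forall k, eqX ((p ^ k)%:R * r) u v) -> u = v.
Proof.
move=> r0 h; apply: eqX_eq => N; have [M hM] := rat_ltn (N%:R / r).
apply: eqX_le (h M); rewrite -ler_pdivrMr //; apply: le_trans (ltW hM) _.
by rewrite ler_nat ltnW // ltn_expl // prime_gt1.
Qed.

Lemma eqX_add1 r u v : eqX r (1 + u) (1 + v) -> eqX r u v.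
Proof.
by move=> h i /h; rewrite !coefED => /addrI.
Qed.

Lemma gamma_ge a x r : 0 < r -> eqX r x 0 -> eqX r (gamma_comp a x) 0.
Proof.
move=> r0 xr; have := gamma_pow (k := 0) a r0 xr.
have -> : a 0%N = 0%N by have := pres_id a 0; rewrite expn0 modn1.
by rewrite expn0 mul1r expr0 -[X in eqX _ _ X]addr0; apply: eqX_add1.
Qed.

Lemma gamma_frob a x r : 0 < r -> eqX r x 0 ->
  gamma_comp a (x ^+ p) = gamma_comp a x ^+ p.
Proof.
move=> r0 xr; apply: (eqX_pk r0) => k; apply: eqX_add1.
have Fr w : 1 + w ^+ p = (1 + w) ^+ p.
  by have := frobD 1 w 1 pcharE; rewrite expn1 expr1n => ->.
have xpr : eqX r (x ^+ p) 0.
  apply: (@eqX_le _ _ (p%:R * r)); last exact: eqX_X0.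
  by rewrite ler_peMl ?ler1n ?prime_gt0 // ltW.
apply: eqX_trans (gamma_pow (k := k) a r0 xpr) _; rewrite !Fr -exprM mulnC exprM.
by apply/eqX_X/eqX_sym/gamma_pow.
Qed.

Lemma gamma_mul a b x r : 0 < r -> eqX r x 0 ->
  gamma_comp b (gamma_comp a x) = gamma_comp (a * b) x.
Proof.
move=> r0 xr; apply: (eqX_pk r0) => k; apply: eqX_add1.
apply: eqX_trans (gamma_pow (k := k) b r0 (gamma_ge a r0 xr)) _.
apply: eqX_trans (eqX_X _ (gamma_pow (k := k) a r0 xr)) _.
apply: eqX_sym; apply: eqX_trans (gamma_pow (k := k) (a * b) r0 xr) _.
rewrite pres_mul -exprM [in X in eqX _ _ X](divn_eq (a k * b k) (p ^ k)).
rewrite exprD [(_ %/ _ * _)%N]mulnC exprM frobD ?pcharE // expr1n.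
rewrite -[X in eqX _ X _]mul1r; apply: eqX_M => //; apply: eqX_sym.
rewrite -[X in eqX _ _ X](expr1n _ (a k * b k %/ p ^ k)); apply: eqX_X.
rewrite -[X in eqX _ _ X]addr0; apply: eqX_D => //.
exact: eqX_X0.
Qed.

Lemma gamma_1 x r : 0 < r -> eqX r x 0 -> gamma_comp (1 : Zp) x = x.
Proof.
move=> r0 xr; apply: (eqX_pk r0) => k; apply: eqX_add1.
apply: (@eqX_le _ _ ((p ^ k.+1)%:R * r)).
  by rewrite ler_pM2r // ler_nat leq_exp2l // prime_gt1.
have := gamma_pow (k := k.+1) 1 r0 xr; rewrite [in X in eqX _ _ X](pres_natr p_pr 1).
by rewrite modn_small // -[1%N](expn0 p) ltn_exp2l // prime_gt1.
Qed.

End CycloAction.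

Section CycloAut.
Variables (p : nat) (p_pr : prime p).
Local Notation E := (Etilde p_pr).
Local Notation Zp := (padic p_pr).
Implicit Types (u v w x y : E) (a b : Zp) (r s : rat) (P Q : {poly 'F_p}).

Local Notation q n := (p%:R ^+ n : rat).
Local Notation xp n k := (k%:R / q n).
Local Notation T n := (rootX p_pr n).
Local Notation g a n := (gamma_comp a (rootX p_pr n)).

Lemma evE y P : horner_alg y P = \sum_(i < size P) P`_i *: y ^+ i.
Proof.
rewrite /horner_alg /horner_morph horner_coef size_map_poly.
by apply: eq_bigr => i _; rewrite coef_map mulr_algl.
Qed.

Lemma ev_compX y P k : horner_alg y (P \Po 'X^k) = horner_alg (y ^+ k) P.
Proof.
rewrite comp_polyE rmorph_sum evE; apply: eq_bigr => i _.
by rewrite -mul_polyC rmorphM /= horner_algC mulr_algl !rmorphXn /= horner_algX.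
Qed.

Lemma coef_evT n P (k : nat) : horner_alg (T n) P (xp n k) = P`_k.
Proof.
rewrite evE coefEsum.
transitivity (\sum_(i < size P) if i == k :> nat then P`_i else 0).
  apply: eq_bigr => i _; rewrite coefEZ rootX_exp coef_mono.
  rewrite (inj_eq (xp_inj p_pr (n := n))) eq_sym.
  by case: eqP => _; rewrite ?mulr1 ?mulr0.
rewrite -big_mkcond /=; case: (ltnP k (size P)) => h.
  by rewrite (big_pred1 (Ordinal h)) // => i; rewrite -val_eqE.
rewrite nth_default // big1 // => i /eqP ik.
by have := ltn_ord i; rewrite ik ltnNge h.
Qed.

Lemma T_gt0 n : 0 < (q n)^-1. Proof. by rewrite invr_gt0 q_gt0. Qed.

Lemma g_root a n m : g a n = g a (m + n) ^+ (p ^ m).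
Proof.
elim: m => [|m IH]; first by rewrite expn0 expr1.
rewrite IH expnS exprM; congr (_ ^+ _).
rewrite -(gamma_frob _ (T_gt0 _) (@rootX_ge _ _ _)).
by rewrite (rootX_root p_pr (m + n) 1) expn1.
Qed.

Lemma ev_cong0 a n P (N : nat) : eqX N%:R (horner_alg (T n) P) 0 ->
  eqX N%:R (horner_alg (g a n) P) 0.
Proof.
move=> h; rewrite evE; apply: eqX_sum0 => i _.
case: (ltnP i (N * p ^ n)) => iN.
  by rewrite -(coef_evT n) h ?scale0r // xp_ltN.
rewrite -(scaler0 _ (P`_i)); apply: eqX_Z.
apply: (@eqX_le _ _ (i%:R * (q n)^-1)).
  by rewrite leNgt xp_ltN // -leqNgt.
apply: eqX_X0; apply: gamma_ge; first exact: T_gt0.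
exact: rootX_ge.
Qed.

Lemma evT_up n m P : (n <= m)%N ->
  horner_alg (T n) P = horner_alg (T m) (P \Po 'X^(p ^ (m - n))).
Proof. by move=> h; rewrite ev_compX (rootX_root p_pr n (m - n)) subnK. Qed.
Lemma evg_up a n m P : (n <= m)%N ->
  horner_alg (g a n) P = horner_alg (g a m) (P \Po 'X^(p ^ (m - n))).
Proof. by move=> h; rewrite ev_compX (g_root a n (m - n)) subnK. Qed.

Lemma ev_cong a n m P Q (N : nat) :
  eqX N%:R (horner_alg (T n) P) (horner_alg (T m) Q) ->
  eqX N%:R (horner_alg (g a n) P) (horner_alg (g a m) Q).
Proof.
have [h0 h1] := (leq_maxl n m, leq_maxr n m).
rewrite (evT_up P h0) (evT_up Q h1) (evg_up a P h0) (evg_up a Q h1).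
move=> /eqX_sub; rewrite -rmorphB => /(ev_cong0 a); rewrite rmorphB.
by move=> h; apply/eqX_sub.
Qed.

Lemma ev_dense u (N : nat) : exists n P, eqX N%:R u (horner_alg (T n) P).
Proof.
have [n L] := lev_ex u N; exists n, (polE n (N * p ^ n) u) => i iN.
case: (eqVneq (u i) 0) => [ui|/(L i iN) [k ik]]; last first.
  by rewrite ik coef_evT coef_poly -(xp_ltN p_pr) -ik iN.
rewrite ui; apply/esym/eqP/negPn/negP => h.
have [k ik] : exists k : nat, i = xp n k.
  apply: contrapT => /forallNP hk; case/eqP: h; rewrite evE coefEsum.
  apply: big1 => k _; rewrite coefEZ rootX_exp coef_mono.
  by case: eqP => [/hk //|_]; rewrite mulr0.
by move: h; rewrite ik coef_evT coef_poly -(xp_ltN p_pr) -ik iN ui eqxx.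
Qed.

(* The graph of the automorphism attached to [a]. *)
Definition cyclo_rel a u v : Prop := forall N : nat, exists n P,
  eqX N%:R u (horner_alg (T n) P) /\ eqX N%:R v (horner_alg (g a n) P).

Lemma cyclo_relE a u v n P (N : nat) : cyclo_rel a u v ->
  eqX N%:R u (horner_alg (T n) P) -> eqX N%:R v (horner_alg (g a n) P).
Proof.
move=> /(_ N) [m [Q [uQ vQ]]] uP; apply: (eqX_trans vQ); apply: ev_cong.
exact: eqX_trans (eqX_sym uQ) uP.
Qed.

Lemma cyclo_rel_ex a u : exists v, cyclo_rel a u v.
Proof.
have /choice [f Hf] : forall N : nat, exists nP : nat * {poly 'F_p},
    eqX N%:R u (horner_alg (T nP.1) nP.2).
  by move=> N; have [n [P h]] := ev_dense u N; exists (n, P).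
pose s N := horner_alg (g a (f N).1) (f N).2.
have sN (N m : nat) : (N <= m)%N -> eqX N%:R (s m) (s N).
  move=> Nm; apply: ev_cong; apply: eqX_trans (Hf N); apply: eqX_sym.
  by apply: eqX_le (Hf m); rewrite ler_nat.
have [N|l sl] := @Etilde_complete _ _ s.
  exists N => m n Nm Nn; apply/valX_ge_sub.
  exact: eqX_trans (sN _ _ Nm) (eqX_sym (sN _ _ Nn)).
exists l => N; exists (f N).1, (f N).2; split=> //.
have [M /(_ (maxn M N) (leq_maxl _ _)) /valX_ge_sub h] := sl N.
exact: eqX_trans (eqX_sym h) (sN _ _ (leq_maxr _ _)).
Qed.

Lemma cyclo_rel_near a u v u' v' (N : nat) : cyclo_rel a u v ->
  cyclo_rel a u' v' -> eqX N%:R u u' -> eqX N%:R v v'.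
Proof.
move=> R R' h; have [n [P [uP vP]]] := R N; apply: (eqX_trans vP).
by apply/eqX_sym/(cyclo_relE R'); apply: eqX_trans (eqX_sym h) uP.
Qed.

Lemma cyclo_rel_fun a u v v' : cyclo_rel a u v -> cyclo_rel a u v' -> v = v'.
Proof. by move=> R R'; apply: eqX_eq => N; apply: (cyclo_rel_near R R'). Qed.

Lemma cyclo_rel_ev a n P :
  cyclo_rel a (horner_alg (T n) P) (horner_alg (g a n) P).
Proof. by move=> N; exists n, P. Qed.

Lemma cyclo_rel2 a u v u' v' (N : nat) : cyclo_rel a u v ->
  cyclo_rel a u' v' -> exists n P Q,
  [/\ eqX N%:R u (horner_alg (T n) P), eqX N%:R v (horner_alg (g a n) P),
      eqX N%:R u' (horner_alg (T n) Q) & eqX N%:R v' (horner_alg (g a n) Q)].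
Proof.
move=> /(_ N) [n [P [uP vP]]] /(_ N) [m [Q [uQ vQ]]].
have [h0 h1] := (leq_maxl n m, leq_maxr n m).
exists (maxn n m), (P \Po 'X^(p ^ (maxn n m - n))),
  (Q \Po 'X^(p ^ (maxn n m - m))).
by rewrite -!evT_up // -!evg_up.
Qed.

Lemma cyclo_aut_hom a : exists s : E -> E,
  [/\ GRing.zmod_morphism s, GRing.monoid_morphism s,
      (forall u, cyclo_rel a u (s u)),
      (forall u v (N : nat), eqX N%:R u v -> eqX N%:R (s u) (s v)) &
      forall n, s (T n) = g a n].
Proof.
have /choice [s Hs] := cyclo_rel_ex a; exists s; split => //.
- move=> u v; apply: cyclo_rel_fun (Hs _) _ => N.
  have [n [P [Q [h1 h2 h3 h4]]]] := cyclo_rel2 N (Hs u) (Hs v).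
  by exists n, (P - Q); rewrite !rmorphB; split; apply: eqX_D => //; apply: eqX_N.
- split.
    apply: cyclo_rel_fun (Hs _) _ => N; exists 0%N, 1.
    by rewrite !rmorph1.
  move=> u v; apply: cyclo_rel_fun (Hs _) _ => N.
  have [n [P [Q [h1 h2 h3 h4]]]] := cyclo_rel2 N (Hs u) (Hs v).
  by exists n, (P * Q); rewrite !rmorphM; split; apply: eqX_M.
- by move=> u v N; apply: cyclo_rel_near.
- move=> n; apply: cyclo_rel_fun (Hs _) _.
  by have := cyclo_rel_ev a n 'X; rewrite !horner_algX.
Qed.

Lemma hom_eqP (s t : E -> E) : GRing.zmod_morphism s -> GRing.monoid_morphism s ->
  GRing.zmod_morphism t -> GRing.monoid_morphism t ->
  continuousX s -> continuousX t -> (forall n, s (T n) = t (T n)) -> s =1 t.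
Proof.
move=> sB sM tB tM sc tc st u.
pose s1 := GRing.isZmodMorphism.Build E E s sB.
pose s2 := GRing.isMonoidMorphism.Build E E s sM.
pose t1 := GRing.isZmodMorphism.Build E E t tB.
pose t2 := GRing.isMonoidMorphism.Build E E t tM.
pose S : {rmorphism E -> E} := HB.pack s s1 s2.
pose T' : {rmorphism E -> E} := HB.pack t t1 t2.
have ev n P : s (horner_alg (T n) P) = t (horner_alg (T n) P).
  rewrite -[s]/(S : E -> E) -[t]/(T' : E -> E) evE !rmorph_sum.
  apply: eq_bigr => i _; rewrite -(natr_Zp P`_i) scaler_nat.
  by rewrite !rmorphMn !rmorphXn /= st.
apply: eqX_eq => N; have [M hM] := sc u N; have [M' hM'] := tc u N.
have [n [P h]] := ev_dense u (maxn M M').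
have /valX_ge_sub e1 : (N%:R%:E <= valX (s (horner_alg (T n) P) - s u)%R)%E.
  apply/hM/valX_ge_sub/eqX_sym; apply: eqX_le h.
  by rewrite ler_nat leq_maxl.
have /valX_ge_sub e2 : (N%:R%:E <= valX (t (horner_alg (T n) P) - t u)%R)%E.
  apply/hM'/valX_ge_sub/eqX_sym; apply: eqX_le h.
  by rewrite ler_nat leq_maxr.
by apply: eqX_trans e2; rewrite -ev; apply: eqX_sym.
Qed.

Lemma cyclo_aut_unique a (s t : E -> E) :
  is_cyclo_aut a s -> is_cyclo_aut a t -> s =1 t.
Proof.
move=> [? ? _ ? hs] [? ? _ ? ht]; apply: hom_eqP => // n.
by rewrite hs ht.
Qed.

Lemma uniform_continuous (s : E -> E) :
  (forall u v (N : nat), eqX N%:R u v -> eqX N%:R (s u) (s v)) ->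
  continuousX s.
Proof.
by move=> h u N; exists N => v /valX_ge_sub /h /valX_ge_sub.
Qed.

Lemma cyclo_aut_comp a b (s t : E -> E) : a * b = 1 ->
  [/\ GRing.zmod_morphism s, GRing.monoid_morphism s,
      (forall u v (N : nat), eqX N%:R u v -> eqX N%:R (s u) (s v)) &
      forall n, s (T n) = g a n] ->
  [/\ GRing.zmod_morphism t, GRing.monoid_morphism t,
      (forall u v (N : nat), eqX N%:R u v -> eqX N%:R (t u) (t v)) &
      forall n, t (T n) = g b n] -> cancel s t.
Proof.
move=> ab [sB [s1 sM] sc sT] [tB [t1 tM] tc tT].
apply: (@hom_eqP (fun u => t (s u)) id) => //.
- by move=> u v; rewrite sB tB.
- by split=> [|u v]; rewrite ?s1 ?t1 // sM tM.
- by apply: uniform_continuous => u v N /sc /tc.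
- by apply: uniform_continuous.
move=> n /=; rewrite sT.
have r0 := T_gt0 n; have Tr := @rootX_ge _ p_pr n.
rewrite -[RHS](gamma_1 r0 Tr) -ab [a * b]mulrC -(gamma_mul b a r0 Tr) -tT.
pose f1 := GRing.isZmodMorphism.Build E E t tB.
pose f2 := GRing.isMonoidMorphism.Build E E t (t1, tM).
pose F : {rmorphism E -> E} := HB.pack t f1 f2.
have Ft w : t w = F w by [].
apply: (eqX_eq) => N.
have tTr : eqX (q n)^-1 (t (T n)) 0 by rewrite tT; apply: gamma_ge.
pose k := (n + N)%N.
have Nk : N%:R <= (p ^ k)%:R * (q n)^-1.
  rewrite ler_pdivlMr ?q_gt0 // -natrX -natrM ler_nat /k addnC expnD.
  by rewrite leq_mul2r ltnW ?orbT // ltn_expl // prime_gt1.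
apply: eqX_add1; have := gamma_pow (k := k) a r0 Tr => /(eqX_le Nk) /tc.
rewrite !Ft rmorphD rmorphXn rmorphD rmorph1 => h; apply: (eqX_trans h).
by apply/eqX_sym/(eqX_le Nk)/gamma_pow.
Qed.

Lemma cyclo_aut_ex a : a \is a GRing.unit -> exists s : E -> E, is_cyclo_aut a s.
Proof.
move=> Ua; have [s [sB sM _ sc sT]] := cyclo_aut_hom a.
have [t [tB tM _ tc tT]] := cyclo_aut_hom a^-1.
exists s; split => //; last exact: uniform_continuous.
by exists t; [apply: (@cyclo_aut_comp a a^-1) | apply: (@cyclo_aut_comp a^-1 a)];
  rewrite ?mulrV ?mulVr.
Qed.

End CycloAut.

(* The action of [a] on [u], i.e. the value at [u] of the unique automorphism
   singled out by [is_cyclo_aut a] (identity when there is none, which does not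
   happen for [a] a unit). *)
HB.lock Definition comp_gamma (p : nat) (p_pr : prime p) (u : Etilde p_pr)
  (a : padic p_pr) : Etilde p_pr :=
  xget (id : Etilde p_pr -> Etilde p_pr) [set s | is_cyclo_aut a s] u.

Lemma comp_gammaP (p : nat) (p_pr : prime p) (a : padic p_pr) :
  a \is a GRing.unit -> is_cyclo_aut a (fun u => comp_gamma u a).
Proof.
move=> /cyclo_aut_ex [s Hs].
have -> : (fun u : Etilde p_pr => comp_gamma u a) =
    xget (id : Etilde p_pr -> Etilde p_pr) [set s | is_cyclo_aut a s].
  by apply: funext => u; rewrite unlock.
by apply: xgetPex; exists s.
Qed.

(* Main.v *)
Require Import Defs.
From HB Require Import structures.
From mathcomp Require Import all_boot all_order all_algebra.
From mathcomp Require Import boolp classical_sets fsbigop constructive_ereal.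
From mathcomp Require Import zify ring.

Import Order.TTheory GRing.Theory Num.Theory.
Local Open Scope ring_scope.

(* Put Y = 1 + X and U = 1 + u, so that a.U = U^a.  After replacing U by a
   power U^(p^l), U = 1 mod X, and a = 1 + p^k gives a.U = U mod X^(p^k).
   Approximate U by a polynomial Q in Y^(1/p^n): a acts by Y -> Y^a, hence
   commutes with the decimation Q |-> sum_i Q_(pi) Y^i, and
   Q(Y^a) = Q + Y Q'(Y) (Y - 1)^(p^k) mod (Y - 1)^(2 p^k).  So every decimation
   of Q down to level m >= 1 has a derivative divisible by a large power of
   Y - 1, i.e. is nearly a polynomial in Y^p; letting k grow, U is in F_p[[X]].
   The same expansion, at level 0, now yields Y dU/dY = c U with c in F_p, so
   that Y^j U is a p-th power V^p when j = - c mod p, and V satisfies the same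
   equation as U.  Iterating, U is congruent to a power of Y modulo X^(p^k) for
   all k, whence U = Y^b with b in Z_p.  Finally b = p^s b' with b' a unit. *)

Set Implicit Arguments.
Unset Strict Implicit.
Unset Printing Implicit Defensive.

(** * Decimation and congruences modulo powers of X - 1 in F_p[X] *)

Section Decimation.
Variables (p : nat) (p_pr : prime p).
Implicit Types P Q R S : {poly 'F_p}.

Let p_gt0 : (0 < p)%N. Proof. exact: prime_gt0. Qed.

Lemma pchar_polyFp : p \in [pchar {poly 'F_p}].
Proof. by rewrite pchar_poly pchar_Fp. Qed.

Lemma subX1_frob k : ('X - 1) ^+ (p ^ k) = 'X^(p ^ k) - 1 :> {poly 'F_p}.
Proof.
apply/eqP; rewrite eq_sym subr_eq -[X in _ + X](expr1n _ (p ^ k)).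
by rewrite -(frobD p_pr) ?pchar_polyFp // subrK.
Qed.

Lemma polyFp_frob k P : P ^+ (p ^ k) = P \Po 'X^(p ^ k).
Proof.
have fr (x : 'F_p) : x ^+ (p ^ k) = x.
  elim: k => [|k IH]; first by rewrite expn0 expr1.
  rewrite expnSr exprM IH.
  by have := pFrobenius_aut_nat (pchar_Fp p_pr) x; rewrite natr_Zp.
elim/poly_ind: P => [|P c IH]; first by rewrite comp_poly0 expr0n -leqn0 leqNgt expn_gt0 p_gt0.
rewrite comp_polyD comp_polyM comp_polyX comp_polyC -IH -exprMn.
by rewrite (frobD p_pr) ?pchar_polyFp // -polyC_exp fr.
Qed.

Lemma comp_subX1 K : ('X - 1) ^+ (K * p) = ('X - 1) ^+ K \Po 'X^p :> {poly 'F_p}.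
Proof.
by rewrite exprM -(expn1 p) polyFp_frob.
Qed.

(** A Cartier operator: a left inverse of [S \Po 'X^p], which over F_p is the p-th power of S. *)
Definition decim P : {poly 'F_p} := \poly_(i < size P) P`_(i * p).

Lemma coef_decim P i : (decim P)`_i = P`_(i * p).
Proof.
rewrite coef_poly; case: ltnP => // h; rewrite nth_default //.
by apply: leq_trans h _; rewrite leq_pmulr.
Qed.

Lemma decimD P Q : decim (P + Q) = decim P + decim Q.
Proof. by apply/polyP => i; rewrite !(coefD, coef_decim). Qed.

Lemma decimB P Q : decim (P - Q) = decim P - decim Q.
Proof. by apply/polyP => i; rewrite !(coefB, coef_decim). Qed.

Lemma decim_compM S Q : decim ((S \Po 'X^p) * Q) = S * decim Q.
Proof.
elim/poly_ind: S Q => [|S c IH] Q.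
  by rewrite comp_poly0 !mul0r; apply/polyP => i; rewrite coef_decim !coef0.
rewrite comp_polyD comp_polyM comp_polyX comp_polyC !mulrDl -!mulrA decimD IH.
congr (S * _ + _); apply/polyP => i.
  rewrite coef_decim coefXnM coefXM coef_decim.
  case: i => [|i]; first by rewrite mul0n p_gt0.
  by rewrite mulSn ltnNge leq_addr /= addKn.
by rewrite coef_decim !coefCM coef_decim.
Qed.

Lemma decim_comp S : decim (S \Po 'X^p) = S.
Proof.
rewrite -[S \Po _]mulr1 decim_compM; suff -> : decim 1 = 1 by rewrite mulr1.
apply/polyP => i; rewrite coef_decim !coef1 muln_eq0.
by rewrite (gtn_eqF p_gt0) orbF.
Qed.

(** As [a] is prime to [p], it divides [i * p] only when it divides [i]. *)
Lemma decim_compXn a Q : (0 < a)%N -> coprime a p ->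
  decim (Q \Po 'X^a) = decim Q \Po 'X^a.
Proof.
move=> a0 ap; apply/polyP => i; rewrite coef_decim !coef_comp_poly_Xn //.
rewrite Gauss_dvdl // coef_decim; case: ifP => // /dvdnP [c ->].
by rewrite mulnAC !mulnK.
Qed.

Lemma dvdp_decim K Q : ('X - 1) ^+ (K * p) %| Q -> ('X - 1) ^+ K %| decim Q.
Proof.
case/dvdpP => A ->; rewrite comp_subX1 mulrC decim_compM.
exact: dvdp_mulr.
Qed.

Lemma dvdp_compXp K Q : ('X - 1) ^+ K %| Q -> ('X - 1) ^+ (K * p) %| Q \Po 'X^p.
Proof. by rewrite comp_subX1; apply: dvdp_comp_poly. Qed.

Lemma poly_taylor2 (A : comNzRingType) (P : {poly A}) (h : {poly A}) :
  exists T : {poly A}, P \Po ('X + h) = P + P^`() * h + h ^+ 2 * T.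
Proof.
elim/poly_ind: P => [|P c [S e]].
  by exists 0; rewrite comp_poly0 deriv0; ring.
exists (S * ('X + h) + P^`()).
rewrite comp_polyD comp_polyM comp_polyX comp_polyC e.
by rewrite derivD derivM derivX derivC; ring.
Qed.

(** By Frobenius X^(1 + p^k) = X + X (X - 1)^(p^k); P is expanded to first order in this
    increment. *)
Lemma comp_X1p_taylor P k : exists S, P \Po 'X^(1 + p ^ k) =
   P + P^`() * 'X * ('X - 1) ^+ (p ^ k) + ('X - 1) ^+ (2 * p ^ k) * S.
Proof.
have -> : 'X^(1 + p ^ k) = 'X + 'X * ('X - 1) ^+ (p ^ k) :> {poly 'F_p}.
  by rewrite subX1_frob exprD expr1; ring.
have [S ->] := poly_taylor2 P ('X * ('X - 1) ^+ (p ^ k)).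
by exists ('X ^+ 2 * S); rewrite mulnC [(_ - _) ^+ (_ * 2)]exprM; ring.
Qed.

Lemma subX1_neq0 K : ('X - 1) ^+ K != 0 :> {poly 'F_p}.
Proof. by rewrite expf_neq0 // -[1]/(1%:P) polyXsubC_eq0. Qed.

Lemma dvdp_subX1_mulX K P : ('X - 1) ^+ K %| P * 'X -> ('X - 1) ^+ K %| P.
Proof.
rewrite Gauss_dvdpl //; apply: coprimep_expl.
rewrite coprimep_sym -[1]/(1%:P) coprimep_XsubC.
by rewrite /root hornerX oner_eq0.
Qed.

Lemma dvdp_XnP K P : reflect (forall i, (i < K)%N -> P`_i = 0) ('X^K %| P).
Proof.
apply: (iffP idP) => [/dvdpP [A ->] i iK|h]; first by rewrite coefMXn iK.
rewrite -(poly_take_drop K P) dvdp_addl ?dvdp_mull //.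
suff -> : take_poly K P = 0 by apply: dvdp0.
by apply/polyP => i; rewrite coef_take_poly coef0; case: ifP => // /h.
Qed.

Lemma dvdp_subX1_comp K P :
  (('X - 1) ^+ K %| P) = ('X^K %| P \Po ('X + 1)).
Proof.
have e1 : ('X - 1) ^+ K \Po ('X + 1) = 'X^K :> {poly 'F_p}.
  by rewrite rmorphXn rmorphB /= comp_polyX comp_polyC addrK.
have e2 : 'X^K \Po ('X - 1) = ('X - 1) ^+ K :> {poly 'F_p}.
  by rewrite comp_Xn_poly.
apply/idP/idP => h; first by rewrite -e1 dvdp_comp_poly.
rewrite -e2 -[P](comp_polyXaddC_K _ 1); apply: dvdp_comp_poly.
by [].
Qed.

(* In the variable [X - 1], the hypothesis kills the coefficients of [R] of
   degree prime to [p], so [R] is a polynomial in [X^p]; the latter is then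
   recovered by decimation. *)
Lemma dvdp_deriv_decim k R : ('X - 1) ^+ (p ^ k.+1) %| R^`() ->
  ('X - 1) ^+ (p ^ k.+1) %| R - (decim R \Po 'X^p).
Proof.
set K := (p ^ k)%N; rewrite expnSr -/K => dR.
suff [S RS] : exists S, ('X - 1) ^+ (K * p) %| R - (S \Po 'X^p).
  have /dvdp_decim := RS; rewrite decimB decim_comp => /dvdp_compXp.
  rewrite comp_polyB => h; have := dvdp_sub RS h.
  by congr (_ %| _); ring.
pose R1 := R \Po ('X + 1); exists (decim R1 \Po ('X - 1)).
have cX : 'X^p \Po ('X + 1) = ('X + 1) \Po 'X^p :> {poly 'F_p}.
  rewrite comp_Xn_poly comp_polyD comp_polyX comp_polyC.
  by have := frobD p_pr 'X 1 1 pchar_polyFp; rewrite !expn1 expr1n.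
rewrite dvdp_subX1_comp comp_polyB -/R1 -[X in _ - X]comp_polyA cX comp_polyA.
have := comp_polyXaddC_K (decim R1) (-1); rewrite polyCN opprK => ->.
move: dR; rewrite dvdp_subX1_comp.
have -> : R^`() \Po ('X + 1) = R1^`().
  by rewrite deriv_comp derivD derivX -[1]/(1%:P) derivC addr0 mulr1.
move=> /dvdp_XnP dR; apply/dvdp_XnP => i iK.
rewrite coefB coef_comp_poly_Xn //.
case: ifP => [/divnK e|/negbT ip]; first by rewrite coef_decim e subrr.
case: i iK ip => [|i] iK ip; first by rewrite dvdn0 in ip.
have := dR i (ltnW iK); rewrite coef_deriv subr0 => /eqP.
rewrite -mulr_natr mulf_eq0 => /orP [/eqP //|].
by rewrite -(dvdn_pcharf (pchar_Fp p_pr)) (negbTE ip).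
Qed.

Lemma coprime_1pX k : coprime (1 + p ^ k.+1) p.
Proof. by rewrite addnC expnSr -coprime_modl modnMDl coprime_modl coprime1n. Qed.

(** Modulo (X - 1)^(2 p^k) the difference is X R' (X - 1)^(p^k); then (X - 1)^(p^k) cancels, and X
    is prime to X - 1. *)
Lemma invariant_dvdp_deriv m k R : (1 < m)%N ->
  ('X - 1) ^+ (m * p ^ k) %| (R \Po 'X^(1 + p ^ k)) - R ->
  ('X - 1) ^+ (p ^ k) %| R^`().
Proof.
move=> m1 h; have [S e] := comp_X1p_taylor R k.
apply: dvdp_subX1_mulX; rewrite -(dvdp_mul2r _ _ (subX1_neq0 (p ^ k))) -exprD.
have {}h : ('X - 1) ^+ (2 * p ^ k) %| (R \Po 'X^(1 + p ^ k)) - R.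
  by apply: dvdp_trans h; rewrite dvdp_exp2l // leq_mul2r m1 orbT.
rewrite addnn -mul2n -(dvdp_addl _ (dvdp_mulr S (dvdpp _))).
by move: h; rewrite e; congr (_ %| _); ring.
Qed.

(** Induction through [decim R]: each decimation costs one factor [p] of precision, whence the p^m
    in the hypothesis. *)
Lemma invariant_level m k R :
  ('X - 1) ^+ (p ^ m * p ^ k.+1) %| (R \Po 'X^(1 + p ^ k.+1)) - R ->
  exists S, ('X - 1) ^+ (p ^ k.+1) %| R - (S \Po 'X^(p ^ m)).
Proof.
elim: m R => [|m IH] R h.
  by exists R; rewrite expn0 expr1 comp_polyXr subrr dvdp0.
have [|S hS] := IH (decim R).
  rewrite -decim_compXn ?coprime_1pX // -decimB; apply: dvdp_decim.
  by rewrite mulnAC -expnSr.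
exists S; have pm : (1 < p ^ m.+1)%N.
  by rewrite -(expn0 p) ltn_exp2l ?prime_gt1.
have hR := dvdp_deriv_decim (invariant_dvdp_deriv pm h).
have {}hS := dvdp_trans (dvdp_exp2l _ (leq_pmulr _ p_gt0)) (dvdp_compXp hS).
have := dvdp_add hR hS; rewrite comp_polyB -comp_polyA comp_Xn_poly -exprM.
by rewrite -expnS; congr (_ %| _); ring.
Qed.

(** [d] decimations turn P(X^(p^d)) into P and keep Q nearly invariant; [invariant_level] then
    treats the remaining [n] levels. *)
Lemma invariant_approx d n N k P Q :
  ('X - 1) ^+ (p ^ (d + n) * p ^ k.+1) %| (Q \Po 'X^(1 + p ^ k.+1)) - Q ->
  ('X - 1) ^+ (N * p ^ (d + n)) %| (P \Po 'X^(p ^ d)) - Q ->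
  (N * p ^ n <= p ^ k.+1)%N ->
  exists S, ('X - 1) ^+ (N * p ^ n) %| P - (S \Po 'X^(p ^ n)).
Proof.
move=> + + hN; elim: d Q => [|d IH] Q hQ hP.
  have [S hS] := invariant_level hQ; exists S.
  have {}hS := dvdp_trans (dvdp_exp2l _ hN) hS.
  have := dvdp_add hP hS; rewrite expn0 expr1 comp_polyXr.
  by congr (_ %| _); ring.
apply: (IH (decim Q)).
  rewrite -decim_compXn ?coprime_1pX // -decimB; apply: dvdp_decim.
  by rewrite mulnAC -expnSr.
rewrite -[P \Po _]decim_comp -decimB; apply: dvdp_decim.
rewrite -mulnA -expnSr; move: hP; congr (_ %| _ - _).
by rewrite -comp_polyA comp_Xn_poly -exprM -expnS.
Qed.

(** Modulo (X - 1)^(2 p^k), P^(p^k) is 1 + c (X - 1)^(p^k). Comparison with the Taylor expansion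
    gives X P' = c P modulo (X - 1)^(p^k), and the factor X^j cancels the eigenvalue c. *)
Lemma eigen_dvdp k c P j :
  ('X - 1) ^+ (2 * p ^ k) %| (P \Po 'X^(1 + p ^ k)) - P ^+ (1 + p ^ k) ->
  ('X - 1) ^+ 2 %| P - (1 + c *: ('X - 1)) -> j%:R = - c ->
  ('X - 1) ^+ (p ^ k) %| (P * 'X^j)^`().
Proof.
set K := (p ^ k)%N => h1 /dvdpP [A e] jc.
have frD (x y : {poly 'F_p}) : (x + y) ^+ K = x ^+ K + y ^+ K.
  by rewrite (frobD p_pr) ?pchar_polyFp.
have cK : c%:P ^+ K = c%:P by rewrite polyFp_frob comp_polyC.
have {}e : P ^+ K = 1 + c *: ('X - 1) ^+ K + ('X - 1) ^+ (2 * K) * A ^+ K.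
  rewrite -[P](subrK (1 + c *: ('X - 1))) e frD frD expr1n exprMn -exprM.
  rewrite -mul_polyC exprMn cK !mul_polyC.
  by rewrite addrC [A ^+ _ * _]mulrC.
have [S eS] := comp_X1p_taylor P k.
apply: dvdp_subX1_mulX; rewrite -(dvdp_mul2r _ _ (subX1_neq0 K)) -exprD.
rewrite addnn -mul2n.
have -> : (P * 'X^j)^`() * 'X * ('X - 1) ^+ K = 'X^j *
    ((P \Po 'X^(1 + K)) - P ^+ (1 + K)) +
    ('X - 1) ^+ (2 * K) * ('X^j * (P * A ^+ K - S)).
  rewrite eS exprD expr1 e derivM derivXn mulrDl -[P * _ * 'X]mulrA.
  have -> : (c *: ('X - 1) ^+ K) = - (j%:R * ('X - 1) ^+ K) :> {poly 'F_p}.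
    by rewrite -[c]opprK -jc -mul_polyC polyCN mulNr -polyC_natr.
  have -> : 'X^(j.-1) *+ j * 'X = j%:R * 'X^j :> {poly 'F_p}.
    case: j {jc} => [|j]; first by rewrite mulr0n !mul0r.
    by rewrite -mulr_natl exprSr mulrA.
  by ring.
by apply: dvdp_add; [apply: dvdp_mull | apply: dvdp_mulr].
Qed.

End Decimation.

(** * Gluing of residues into p-adic integers; units *)

Section PadicUnits.
Variables (p : nat) (p_pr : prime p).
Local Notation Zp := (padic p_pr).
Implicit Types a b : Zp.

Lemma padic_of_residues (P : nat -> nat -> Prop) :
  (forall n, exists2 x, (x < p ^ n)%N & P n x) ->
  (forall n x, P n.+1 x -> P n (x %% p ^ n)%N) ->
  (forall n x y, (x < p ^ n)%N -> (y < p ^ n)%N -> P n x -> P n y -> x = y) ->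
  exists a : Zp, forall n, P n (a n).
Proof.
move=> ex red uniq.
have /choice [f Hf] : forall n, exists x, (x < p ^ n)%N /\ P n x.
  by move=> n; have [x xn Px] := ex n; exists x.
have fP n : f n = (f n.+1 %% p ^ n)%N.
  apply: (uniq n); try by case: (Hf n).
    by rewrite ltn_pmod // pX_gt0.
  by apply: red; case: (Hf n.+1).
by exists (@Padic p p_pr f fP) => n; case: (Hf n).
Qed.

Lemma padic_unitE a : a 1%N != 0%N -> a \is a GRing.unit.
Proof.
move=> a1; have cop n : coprime (a n) (p ^ n).
  case: n => [|n]; first by rewrite expn0 coprimen1.
  apply: coprimeXr; rewrite coprime_sym prime_coprime //.
  apply: contraNN a1 => pa; have := pres_mod a (ltn0Sn n); rewrite expn1.
  by move=> <-; rewrite (eqnP pa).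
have [|||b Hb] := @padic_of_residues (fun n x => x * a n = 1 %[mod p ^ n])%N.
- move=> n; case: (eqVneq (a n) 0%N) => [an|an].
    (* Here p^n = 1, since 0 is prime to p^n; [egcdnP] below needs [a n] positive. *)
    exists 0%N; first exact: pX_gt0.
    by move: (cop n); rewrite an /coprime gcd0n => /eqP ->; rewrite !modn1.
  have an0 : (0 < a n)%N by rewrite lt0n.
  have [x y c _] := egcdnP (p ^ n) an0.
  exists (x %% p ^ n)%N; first by rewrite ltn_pmod ?pX_gt0.
  rewrite modnMml c; move: (cop n); rewrite /coprime => /eqP ->.
  by rewrite modnMDl.
- move=> n x /(congr1 (modn^~ (p ^ n)))%N; rewrite !pres_modS => <-.
  by rewrite modnMml (presP a n) modnMmr.
- move=> n x y xn yn hx hy.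
  rewrite -(modn_small xn) -(modn_small yn); apply/eqP.
  rewrite -[x]muln1 -[y]muln1 -modnMmr -hy modnMmr -[X in _ == X]modnMmr -hx modnMmr.
  by apply/eqP; congr modn; ring.
apply/unitrP; exists b.
have e : b * a = 1 by apply: padicP => n; rewrite pres_mul Hb (pres_natr p_pr 1).
by rewrite [a * b]mulrC e.
Qed.

Lemma padic_unit_nat n : coprime n p -> (n%:R : Zp) \is a GRing.unit.
Proof.
move=> np; apply: padic_unitE; rewrite pres_natr expn1.
by rewrite -/(dvdn p n) -prime_coprime // coprime_sym.
Qed.

(** [s.+1] is the least level where the residue of [a] is nonzero; the unit has residues a (n + s) /
    p^s. *)
Lemma padic_factor a : a != 0 ->
  exists s b, b \is a GRing.unit /\ a = (p ^ s)%:R * b.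
Proof.
move=> a0; have ex : exists n, a n != 0%N.
  apply: contrapT => /forallNP h; move/eqP: a0; apply; apply: padicP => n.
  by rewrite (pres_natr p_pr 0) mod0n; apply/eqP/negPn/negP/h.
case: (ex_minnP ex) => -[|s] as0 min_s.
  by have := pres_id a 0; rewrite expn0 modn1 => e; rewrite -e eqxx in as0.
have as_ : a s = 0%N.
  by apply/eqP; apply: contraT => /min_s; rewrite ltnn.
have dv n : (p ^ s %| a (n + s))%N.
  by rewrite /dvdn pres_mod ?leq_addl // as_.
have bP n : (a (n + s) %/ p ^ s = (a (n.+1 + s) %/ p ^ s) %% p ^ n)%N.
  have /dvdnP [x e] := dv n.+1; rewrite e mulnK ?pX_gt0 //.
  have := presP a (n + s); rewrite -addSn e expnD -muln_modl => ->.
  by rewrite mulnK ?pX_gt0.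
exists s, (@Padic p p_pr _ bP); split.
  apply: padic_unitE => /=; rewrite -lt0n divn_gt0 ?pX_gt0 //.
  by apply: dvdn_leq; [rewrite lt0n | apply: dv].
apply: padicP => n; rewrite pres_mul pres_natr /= modnMml mulnC divnK //.
by rewrite pres_mod // leq_addr.
Qed.

End PadicUnits.

(** * Evaluation of polynomials at the p-power roots of Y = 1 + X *)

Section Evaluation.
Variables (p : nat) (p_pr : prime p).
Local Notation E := (Etilde p_pr).
Implicit Types (u v w x y : E) (P Q : {poly 'F_p}).

Local Notation q n := (p%:R ^+ n : rat).
Local Notation xp n k := (k%:R / q n).
Local Notation T n := (Defs.rootX p_pr n).
(** This is P(Y^(1/p^n)); in this variable the action is substitution of a power. *)
Local Notation ev n P := (horner_alg (1 + Defs.rootX p_pr n) P).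

Lemma coefE1 i : (1 : E) i = if i == 0 then 1 else 0.
Proof. by rewrite -[1 in LHS]/(oneE p_pr) coef_mono mul0r. Qed.

Lemma horner_alg_comp y P Q :
  horner_alg y (P \Po Q) = horner_alg (horner_alg y Q) P.
Proof.
rewrite comp_polyE rmorph_sum evE; apply: eq_bigr => i _.
by rewrite -mul_polyC rmorphM /= horner_algC mulr_algl !rmorphXn.
Qed.

Lemma ev_rootX n P : ev n P = horner_alg (T n) (P \Po ('X + 1)).
Proof.
by rewrite horner_alg_comp rmorphD rmorph1 /= horner_algX addrC.
Qed.

Lemma coef_horner_rootX n P i : horner_alg (T n) P i != 0 ->
  exists k : nat, i = xp n k.
Proof.
move=> h; apply: contrapT => /forallNP hk; case/eqP: h; rewrite evE coefEsum.
apply: big1 => k _; rewrite coefEZ rootX_exp coef_mono.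
by case: eqP => [/hk //|_]; rewrite mulr0.
Qed.

(** After recentring at 1, the coefficient of X^(k/p^n) is that of (X - 1)^k in P. *)
Lemma ev_eqX0 n K P : eqX (xp n K) (ev n P) 0 <-> ('X - 1) ^+ K %| P.
Proof.
rewrite dvdp_subX1_comp // ev_rootX; split => [h|/dvdp_XnP h i iK].
  by apply/dvdp_XnP => i iK; rewrite -(coef_evT p_pr n) h // xp_lt.
apply/eqP; apply: contraTT iK => ci; have [k ik] := coef_horner_rootX ci.
rewrite ik xp_lt //; apply: contraNN ci => kK.
by rewrite ik coef_evT h.
Qed.

Lemma ev_eqX n N P Q :
  eqX N%:R (ev n P) (ev n Q) <-> ('X - 1) ^+ (N * p ^ n) %| P - Q.
Proof.
rewrite -(ev_eqX0 n) rmorphB /= -eqX_sub natrM natrX mulfK ?q_neq0 //.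
Qed.

Lemma ev_up n d P : ev n P = ev (d + n) (P \Po 'X^(p ^ d)).
Proof.
rewrite ev_compX (rootX_root p_pr n d) frobD ?pcharE // expr1n.
by [].
Qed.

Lemma ev_approx u (N : nat) : exists n P, eqX N%:R u (ev n P).
Proof.
have [n [P h]] := ev_dense u N; exists n, (P \Po ('X - 1)).
rewrite horner_alg_comp rmorphB rmorph1 /= horner_algX.
by rewrite addrC addrA addNr add0r.
Qed.

(** * Orders of powers and injectivity of Frobenius *)

Lemma is_orderM u v i j : is_order u i -> is_order v j ->
  (u * v) (i + j) = u i * v j.
Proof.
move=> [ui hi] [vj hj]; rewrite coefEM (fsbigE [:: i]) //=; last first.
  move=> l _; rewrite inE => li; case: (ltgtP l i) => [l_i|l_i|e].
  - by rewrite hi // mul0r.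
  - by rewrite [v _]hj ?mulr0 // -[X in _ < X](addKr i) addrC ltrD2r ltrN2.
  - by rewrite e eqxx in li.
by rewrite big_mkcond big_seq1 in_setT addrC addKr.
Qed.

Lemma is_orderX u i k : is_order u i -> is_order (u ^+ k) (k%:R * i).
Proof.
move=> ui; elim: k => [|k IH]; rewrite ?expr0 ?mul0r.
  split=> [|j j0]; last exact: coef_lt0.
  by rewrite coefE1 eqxx oner_neq0.
split; last by apply: eqX_X0; case: ui.
rewrite exprS -natr1 mulrDl mul1r addrC is_orderM // mulf_neq0 //.
  by case: ui.
by case: IH.
Qed.

Lemma eqX_X_inv0 r u k : (0 < k)%N -> eqX (k%:R * r) (u ^+ k) 0 -> eqX r u 0.
Proof.
move=> k0 h; case: (eqVneq u 0) => [-> //|/order_ex [i ui]].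
have [uik _] := is_orderX k ui; case: (ui) => _ hi; apply: (@eqX_le _ _ i) => //.
rewrite leNgt; apply: contraNN uik => ir; rewrite h //.
by rewrite ltr_pM2l // ltr0n.
Qed.

Lemma frobB u v k : (u - v) ^+ (p ^ k) = u ^+ (p ^ k) - v ^+ (p ^ k).
Proof.
apply/eqP; rewrite eq_sym subr_eq -(frobD p_pr) ?pcharE //.
by rewrite subrK.
Qed.

Lemma eqX_frob_inv r u v k :
  eqX ((p ^ k)%:R * r) (u ^+ (p ^ k)) (v ^+ (p ^ k)) -> eqX r u v.
Proof.
move=> /eqX_sub; rewrite -frobB => h; apply/eqX_sub.
by apply: eqX_X_inv0 h; rewrite expn_gt0 prime_gt0.
Qed.

Lemma frob_inj u v k : u ^+ (p ^ k) = v ^+ (p ^ k) -> u = v.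
Proof. by move=> e; apply: eqX_eq => N; apply: (@eqX_frob_inv _ _ _ k); rewrite e. Qed.

Lemma gamma_nat x r n : 0 < r -> eqX r x 0 ->
  1 + gamma_comp (n%:R : padic p_pr) x = (1 + x) ^+ n.
Proof.
move=> r0 xr; apply: (eqX_pk r0) => k.
apply: (@eqX_le _ _ ((p ^ (n + k))%:R * r)).
  by rewrite ler_pM2r // ler_nat leq_exp2l ?prime_gt1 // leq_addl.
have := gamma_pow (k := (n + k)%N) n%:R r0 xr.
rewrite pres_natr modn_small //; apply: leq_trans (ltn_expl n (prime_gt1 p_pr)) _.
by rewrite leq_exp2l ?prime_gt1 // leq_addr.
Qed.

(** * The action of the units 1 + p^(k+1) *)

Definition cyc k u : E := comp_gamma u (1 + p ^ k.+1)%:R.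

Lemma unit_1pX k : ((1 + p ^ k.+1)%:R : padic p_pr) \is a GRing.unit.
Proof. by apply/padic_unit_nat/coprime_1pX. Qed.

Lemma cyc_is_zmod k : GRing.zmod_morphism (cyc k).
Proof. by case: (comp_gammaP (unit_1pX k)). Qed.
Lemma cyc_is_monoid k : GRing.monoid_morphism (cyc k).
Proof. by case: (comp_gammaP (unit_1pX k)). Qed.
HB.instance Definition _ k :=
  GRing.isZmodMorphism.Build E E (cyc k) (@cyc_is_zmod k).
HB.instance Definition _ k :=
  GRing.isMonoidMorphism.Build E E (cyc k) (@cyc_is_monoid k).

(** [is_cyclo_aut] records continuity only; preservation of precision is transferred from the map
    built in [cyclo_aut_hom], which agrees with [cyc k] by [hom_eqP]. *)
Lemma cyc_eqX k u v (N : nat) : eqX N%:R u v -> eqX N%:R (cyc k u) (cyc k v).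
Proof.
have [s [sB sM _ sc sT]] := cyclo_aut_hom ((1 + p ^ k.+1)%:R : padic p_pr).
have [cB cM _ cc cT] := comp_gammaP (unit_1pX k).
have e : cyc k =1 s.
  by apply: hom_eqP => //; [exact: uniform_continuous | move=> n; rewrite sT; apply: cT].
by rewrite !e; apply: sc.
Qed.

Lemma cyc_ev k n P : cyc k (ev n P) = ev n (P \Po 'X^(1 + p ^ k.+1)).
Proof.
have [_ _ _ _ cT] := comp_gammaP (unit_1pX k).
have {}cT : cyc k (T n) = gamma_comp (1 + p ^ k.+1)%:R (T n) := cT n.
rewrite ev_compX !evE rmorph_sum; apply: eq_bigr => i _.
rewrite -(natr_Zp P`_i) !scaler_nat rmorphMn rmorphXn rmorphD rmorph1 /=.
by rewrite cT (gamma_nat _ (T_gt0 p_pr n) (@rootX_ge _ p_pr n)).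
Qed.

(* The equation satisfied by [u = 1 + X], restricted to the units
   [1 + p ^ k.+1], which suffice. *)
Definition semi_invariant u := forall k, cyc k u = u ^+ (1 + p ^ k.+1).

(* [u] lies in F_p[[X]], the closure of [F_p[1 + X]]. *)
Definition in_powser u := forall N : nat, exists P, eqX N%:R u (ev 0 P).

(** * Solutions congruent to 1 modulo X are power series in X *)

Lemma eqX1_frob u k : eqX 1 u 1 -> eqX (p ^ k)%:R (u ^+ (p ^ k)) 1.
Proof.
move=> /eqX_sub h; apply/eqX_sub.
rewrite -[X in eqX _ (_ - X) _](expr1n _ (p ^ k)) -frobB -[_%:R]mulr1.
exact: eqX_X0.
Qed.

Lemma semi_invariant_near u k : semi_invariant u -> eqX 1 u 1 ->
  eqX (p ^ k.+1)%:R (cyc k u) u.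
Proof.
move=> su u1; rewrite su exprD expr1 -[X in eqX _ _ X]mulr1.
by apply: eqX_M => //; apply: eqX1_frob.
Qed.

(** P approximates u at some level n. A finer, nearly invariant Q serves only to show that P is
    close to a polynomial in the p^n-th power of its variable, that is, to one at level 0. *)
Lemma semi_invariant_powser u : semi_invariant u -> eqX 1 u 1 -> in_powser u.
Proof.
move=> su u1 N; have [n [P uP]] := ev_approx u N.
pose k := (N + n)%N.
have Nk : (N * p ^ n <= p ^ k.+1)%N.
  apply: (@leq_trans (p ^ k)); last by rewrite leq_exp2l ?prime_gt1.
  by rewrite expnD leq_mul2r ltnW ?orbT // ltn_expl ?prime_gt1.
have [n' [Q' uQ']] := ev_approx u (p ^ k.+1).
(* Rewriting Q' at level n' + n makes its level exceed that of P by d = n'. *)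
pose Q := Q' \Po 'X^(p ^ n); pose d := n'.
have uQ : eqX (p ^ k.+1)%:R u (ev (d + n) Q) by rewrite addnC -ev_up.
have cQ := eqX_trans (eqX_sym (cyc_eqX k uQ))
  (eqX_trans (@semi_invariant_near u k su u1) uQ).
have PQ : eqX N%:R (ev n P) (ev (d + n) Q).
  apply: eqX_trans (eqX_sym uP) _; apply: eqX_le uQ.
  rewrite ler_nat; apply: leq_trans Nk.
  by rewrite leq_pmulr // expn_gt0 prime_gt0.
move: cQ PQ; rewrite cyc_ev (ev_up n d) !ev_eqX [(p ^ k.+1 * _)%N]mulnC => cQ PQ.
have [S PS] := invariant_approx p_pr cQ PQ Nk; exists S.
apply: (eqX_trans uP); rewrite (ev_up 0 n) addn0.
by apply/ev_eqX.
Qed.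

Lemma semi_invariantM u v : semi_invariant u -> semi_invariant v ->
  semi_invariant (u * v).
Proof. by move=> su sv k; rewrite rmorphM /= su sv exprMn. Qed.

Lemma semi_invariantX u n : semi_invariant u -> semi_invariant (u ^+ n).
Proof. by move=> su k; rewrite rmorphXn /= su exprAC. Qed.

Lemma semi_invariant_root u k : semi_invariant (u ^+ (p ^ k)) -> semi_invariant u.
Proof.
move=> su l; apply: (@frob_inj _ _ k).
by rewrite -rmorphXn /= su exprAC.
Qed.

(** * Extraction of p-th roots after multiplication by a power of Y *)

Lemma varX_ge : eqX 1 (varX p_pr) 0.
Proof. by have := @rootX_ge _ p_pr 0; rewrite expr0 invr1. Qed.

Lemma ev0X : ev 0 'X = 1 + varX p_pr. Proof. by rewrite horner_algX. Qed.

Lemma semi_invariant_Y : semi_invariant (1 + varX p_pr).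
Proof. by move=> k; rewrite -ev0X cyc_ev comp_polyX rmorphXn. Qed.

Lemma powser_eqX1 u : in_powser u -> u 0 = 1 -> eqX 1 u 1.
Proof.
move=> /(_ 1%N) [P uP] u0 i i1.
rewrite coefE1; case: eqP => [-> //|/eqP i0].
rewrite uP // ev_rootX; apply/eqP; apply: contraNT i0 => h.
have [m im] := coef_horner_rootX h; move: i1; rewrite im expr0 divr1.
by rewrite -[X in _ < X]/(1%:R) ltr_nat ltnS leqn0 => /eqP ->.
Qed.

Lemma coef0_X u n : (u ^+ n) 0 = u 0 ^+ n.
Proof.
have c0M v w : (v * w) 0 = v 0 * w 0.
  rewrite coefEM (fsbigE [:: 0]) //=; last first.
    move=> l _; rewrite inE; case: (ltgtP l 0) => [l0 _|l0 _|-> /eqP //].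
      by rewrite (coef_lt0 _ l0) mul0r.
    by rewrite [w _]coef_lt0 ?mulr0 // sub0r oppr_lt0.
  by rewrite big_mkcond big_seq1 in_setT subr0.
elim: n => [|n IH]; last by rewrite !exprS c0M IH.
by rewrite !expr0 coefE1 eqxx.
Qed.

(* The equation amounts to [Y dU/dY = c U] for [c] the linear coefficient of
   [U], so that [Y^j U] has derivative [0] for [j = - c]. *)
Lemma semi_invariant_deriv u : semi_invariant u -> in_powser u -> eqX 1 u 1 ->
  exists j, forall N : nat, exists S,
    eqX N%:R (u * (1 + varX p_pr) ^+ j) (ev 0 S ^+ p).
Proof.
move=> su iu u1; pose c := u 1; exists (- c : 'F_p)%R => N.
pose k := N; have Nk : (N <= p ^ k.+1)%N.
  by apply: ltnW; apply: leq_trans (ltn_expl _ (prime_gt1 p_pr)) _; rewrite leq_exp2l ?prime_gt1.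
(* The factor 2 leaves precision p^(k+1) once (Y - 1)^(p^(k+1)) is cancelled. *)
have [P uP] := iu (2 * p ^ k.+1)%N.
pose R := P * 'X^(- c : 'F_p)%R.
exists (decim R); rewrite -rmorphXn /=.
have := polyFp_frob p_pr 1 (decim R); rewrite expn1 => ->.
apply: (@eqX_trans _ _ _ (ev 0 R)).
  rewrite rmorphM rmorphXn /= ev0X; apply: eqX_M => //.
  apply: eqX_le uP; rewrite ler_nat (leq_trans Nk) // leq_pmull //.
apply/ev_eqX; rewrite expn0 muln1.
apply: dvdp_trans (dvdp_exp2l _ Nk) _; apply: dvdp_deriv_decim => //.
apply: (@eigen_dvdp p p_pr _ c); last by rewrite natr_Zp.
- suff /ev_eqX : eqX (2 * p ^ k.+1)%:R (ev 0 (P \Po 'X^(1 + p ^ k.+1)))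
      (ev 0 (P ^+ (1 + p ^ k.+1))) by rewrite expn0 muln1.
  rewrite -cyc_ev rmorphXn /=.
  apply: eqX_trans (eqX_sym (cyc_eqX k uP)) _; rewrite su.
  exact: eqX_X.
- rewrite dvdp_subX1_comp //; apply/dvdp_XnP => i i2.
  have e : ev 0 (P - (1 + c *: ('X - 1))) = ev 0 P - (1 + c *: varX p_pr).
    rewrite rmorphB rmorphD rmorph1 -mul_polyC rmorphM rmorphB rmorph1 /=.
    by rewrite horner_algC horner_algX mulr_algl [1 + _ - 1]addrC addKr.
  rewrite -[LHS](coef_evT p_pr 0) -ev_rootX e coefEB -(uP (xp 0 i)); last first.
    rewrite expr0 divr1 ltr_nat (leq_trans i2) // leq_pmulr //.
    by rewrite expn_gt0 prime_gt0.
  rewrite coefED coefEZ coefE1 coef_mono !expr0 !divr1.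
  case: i i2 => [|[|//]] _.
    by rewrite eqxx /= mulr0 addr0 u1 // coefE1 eqxx subrr.
  by rewrite /= mulr1 add0r subrr.
Qed.

(** The approximate p-th roots form a Cauchy sequence; a p-th root divides the precision by [p],
    hence the index [p * N]. *)
Lemma semi_invariant_step u : semi_invariant u -> in_powser u -> eqX 1 u 1 ->
  exists j v, [/\ semi_invariant v, in_powser v, eqX 1 v 1 &
    v ^+ p = u * (1 + varX p_pr) ^+ j].
Proof.
move=> su iu u1; have [j /choice [S hS]] := semi_invariant_deriv su iu u1.
pose w := u * (1 + varX p_pr) ^+ j; rewrite -/w in hS.
exists j; pose s N := ev 0 (S (p * N)%N).
have sN (N M : nat) : (N <= M)%N -> eqX N%:R (s M) (s N).
  move=> NM; apply: (@eqX_frob_inv _ _ _ 1); rewrite expn1 -natrM.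
  apply: eqX_trans (hS _); apply: eqX_sym.
  by apply: eqX_le (hS _); rewrite ler_nat leq_mul2l NM orbT.
have [N|v sv] := @Etilde_complete _ _ s.
  exists N => m n Nm Nn; apply/valX_ge_sub.
  exact: eqX_trans (sN _ _ Nm) (eqX_sym (sN _ _ Nn)).
have vs N : eqX N%:R v (s N).
  have [M /(_ (maxn M N) (leq_maxl _ _)) /valX_ge_sub h] := sv N.
  exact: eqX_trans (eqX_sym h) (sN _ _ (leq_maxr _ _)).
have vw : v ^+ p = w.
  apply: eqX_eq => N; apply: eqX_trans (eqX_X p (vs N)) _; apply: eqX_sym.
  by apply: eqX_le (hS _); rewrite ler_nat leq_pmull ?prime_gt0.
have iv : in_powser v by move=> N; exists (S (p * N)%N); apply: vs.
exists v; split => //.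
  apply: (@semi_invariant_root _ 1); rewrite expn1 vw.
  by apply: semi_invariantM => //; apply/semi_invariantX/semi_invariant_Y.
apply: powser_eqX1 => //.
(* In F_p, v(0)^p = v(0), so v(0) is the constant coefficient of w, namely 1. *)
have := coef0_X v p; rewrite vw.
have := pFrobenius_aut_nat (pchar_Fp p_pr) (v 0); rewrite natr_Zp.
rewrite pFrobenius_autE => -> <-.
have w1 : eqX 1 w 1.
  have : eqX 1 w (1 * 1 ^+ j).
    apply: eqX_M => //; apply: eqX_X; rewrite -[X in eqX _ _ X]addr0.
    by apply: eqX_D => //; apply: varX_ge.
  by rewrite expr1n mulr1.
by rewrite w1 // coefE1 eqxx.
Qed.

(** Iterated root extraction gives u Y^j = v^(p^k) with v = 1 modulo X, and Frobenius raises the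
    precision to p^k. *)
Lemma semi_invariant_iter k u : semi_invariant u -> in_powser u -> eqX 1 u 1 ->
  exists j, eqX (p ^ k)%:R (u * (1 + varX p_pr) ^+ j) 1.
Proof.
move=> su iu u1.
suff [j [v [_ _ v1 e]]] : exists j v, [/\ semi_invariant v, in_powser v, eqX 1 v 1
    & v ^+ (p ^ k) = u * (1 + varX p_pr) ^+ j].
  by exists j; rewrite -e; apply: eqX1_frob.
elim: k => [|k [j [v [sv iv v1 e]]]].
  by exists 0%N, u; rewrite expn0 !expr1 expr0 mulr1.
have [l [w [sw iw w1 ew]]] := semi_invariant_step sv iv v1.
exists (j + l * p ^ k)%N, w; split=> //.
by rewrite expnS exprM ew exprMn e -exprM exprD mulrA.
Qed.

(** * Powers of Y modulo X^(p^k) and the p-adic exponent *)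

Lemma eqX_Y_pk k n : eqX (p ^ k)%:R ((1 + varX p_pr) ^+ (p ^ k * n)) 1.
Proof.
rewrite exprM -[X in eqX _ _ X](expr1n _ n); apply/eqX_X/eqX1_frob.
rewrite -[X in eqX _ _ X]addr0; apply: eqX_D => //.
exact: varX_ge.
Qed.

Lemma eqX_Y_mod k (x : nat) : eqX (p ^ k)%:R ((1 + varX p_pr) ^+ (x %% p ^ k)) ((1 + varX p_pr) ^+ x).
Proof.
rewrite [in X in eqX _ _ X](divn_eq x (p ^ k)) exprD mulnC.
rewrite -[X in eqX _ X _]mul1r; apply: eqX_M => //; apply: eqX_sym.
exact: eqX_Y_pk.
Qed.

Lemma coef_Y d : ((1 + varX p_pr) ^+ d) d%:R = 1.
Proof.
have -> : (1 + varX p_pr) ^+ d = ev 0 'X^d by rewrite rmorphXn /= ev0X.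
rewrite ev_rootX comp_Xn_poly.
have := coef_evT p_pr 0 (('X + 1) ^+ d) d; rewrite expr0 divr1 => ->.
by rewrite addrC coef_1DXn // binn.
Qed.

(** Otherwise Y^d would be 1 modulo X^(p^k) for some 0 < d < p^k, although its coefficient of X^d is
    1. *)
Lemma eqX_Y_inj k (x y : nat) : (x < p ^ k)%N -> (y < p ^ k)%N ->
  eqX (p ^ k)%:R ((1 + varX p_pr) ^+ x) ((1 + varX p_pr) ^+ y) -> x = y.
Proof.
wlog xy : x y / (x <= y)%N.
  move=> W; case: (leqP x y) => [|/ltnW] le xk yk h; first exact: W.
  by apply/esym/W => //; apply: eqX_sym.
move=> xk yk h; apply/eqP; rewrite eqn_leq xy /= -subn_eq0.
pose d := (y - x)%N; rewrite -/d; apply/negPn/negP => d0.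
have dk : (d < p ^ k)%N by rewrite (leq_ltn_trans _ yk) // leq_subr.
have : eqX (p ^ k)%:R ((1 + varX p_pr) ^+ d) 1.
  (* Multiplying by Y^(p^k - x) replaces division by Y^x, as Y^(p^k) is 1 to this precision. *)
  have h1 := eqX_M h (@eqX_refl _ _ _ ((1 + varX p_pr) ^+ (p ^ k - x))).
  move: h1; rewrite -!exprD subnKC; last exact: ltnW.
  have -> : (y + (p ^ k - x) = d + p ^ k)%N.
    by rewrite addnBA ?(ltnW xk) // addnBAC.
  have := @eqX_Y_pk k 1; rewrite muln1 => h2 /eqX_sym h1.
  apply: eqX_trans (eqX_trans h1 h2); rewrite exprD -[X in eqX _ X _]mulr1.
  by apply: eqX_M => //; apply: eqX_sym.
move=> /(_ d%:R); rewrite ltr_nat => /(_ dk); rewrite coef_Y.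
rewrite coefE1 pnatr_eq0 (negbTE d0).
by move=> /eqP; rewrite oner_eq0.
Qed.

Lemma semi_invariant_gamma u : semi_invariant u -> eqX 1 u 1 ->
  exists b : padic p_pr, u = 1 + gamma_comp b (varX p_pr).
Proof.
move=> su u1; have iu := semi_invariant_powser su u1.
have [|||b Hb] := @padic_of_residues p p_pr
  (fun k (x : nat) => eqX (p ^ k)%:R u ((1 + varX p_pr) ^+ x)).
- move=> k; have [j hj] := semi_invariant_iter k su iu u1.
  (* The residue of -j, through its natural representative p^k j - j. *)
  exists ((p ^ k * j - j) %% p ^ k)%N; first by rewrite ltn_pmod ?pX_gt0.
  apply: eqX_sym; apply: eqX_trans (@eqX_Y_mod _ _) _.
  have jj : (j <= p ^ k * j)%N by rewrite leq_pmull ?pX_gt0.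
  have h1 := eqX_M hj (@eqX_refl _ _ _ ((1 + varX p_pr) ^+ (p ^ k * j - j))).
  move: h1; rewrite mul1r -mulrA -exprD subnKC // => /eqX_sym h1.
  apply: (eqX_trans h1); rewrite -[X in eqX _ _ X]mulr1.
  by apply: eqX_M => //; apply: eqX_Y_pk.
- move=> k x h; have kk : (p ^ k)%:R <= (p ^ k.+1)%:R :> rat.
    by rewrite ler_nat leq_exp2l ?prime_gt1.
  by apply: eqX_trans (eqX_le kk h) _; apply/eqX_sym/eqX_Y_mod.
- move=> k x y xk yk hx hy; apply: eqX_Y_inj xk yk _.
  exact: eqX_trans (eqX_sym hx) hy.
exists b; apply: (@eqX_pk _ p_pr 1) => // k.
apply: eqX_trans (eqX_sym (gamma_pow b _ varX_ge)) => //.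
by rewrite mulr1; apply: Hb.
Qed.

Lemma gamma_varX s :
  gamma_comp ((p ^ s)%:R : padic p_pr) (varX p_pr) = varX p_pr ^+ (p ^ s).
Proof.
apply: (addrI 1); rewrite (gamma_nat _ ltr01 varX_ge).
by rewrite (frobD p_pr) ?pcharE // expr1n.
Qed.

Lemma gamma_frobX c x r k : 0 < r -> eqX r x 0 ->
  gamma_comp c (x ^+ (p ^ k)) = gamma_comp c x ^+ (p ^ k).
Proof.
move=> r0 xr; elim: k => [|k IH]; first by rewrite expn0 !expr1.
rewrite expnSr !exprM -IH (@gamma_frob _ _ _ _ r) //.
apply: (@eqX_le _ _ ((p ^ k)%:R * r)); last exact: eqX_X0.
by rewrite ler_peMl ?(ltW r0) // ler1n pX_gt0.
Qed.

End Evaluation.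

(** * Recovery of u from its p^l-th power *)

Unset Implicit Arguments.
Set Strict Implicit.
Set Printing Implicit Defensive.

(* [u != 0] is implicit in the paper: for [u = 0], where [valX u = +oo], the
   commutation holds and the conclusion fails. *)
Theorem theorem3p1 (p : nat) (p_pr : prime p) (u : Etilde p_pr) :
  u != 0 -> (0 < valX u)%E ->
  (forall a : padic p_pr, a \is a GRing.unit ->
     comp_gamma u a = gamma_comp a u) ->
  exists (b : padic p_pr) (n : int),
    b \is a GRing.unit /\ u = gamma_comp b (Xpow_p p_pr n).
Proof.
move=> u0 /valX_gt0 [r r0 ur] hu.
have su : semi_invariant (1 + u).
  move=> k; rewrite rmorphD rmorph1 -(gamma_nat _ r0 ur); congr (1 + _).
  exact/hu/unit_1pX.
(* Since 1/r < l < p^l, the series u^(p^l) vanishes modulo X. *)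
have [l rl] := rat_ltn r^-1.
have u1 : eqX 1 ((1 + u) ^+ (p ^ l)) 1.
  rewrite (frobD p_pr) ?pcharE // expr1n -[X in eqX _ _ X]addr0.
  apply: eqX_D => //; apply: (@eqX_le _ _ ((p ^ l)%:R * r)); last exact: eqX_X0.
  rewrite -ler_pdivrMr // mul1r; apply: le_trans (ltW rl) _.
  by rewrite ler_nat ltnW // ltn_expl ?prime_gt1.
have [b hb] := semi_invariant_gamma (semi_invariantX (p ^ l) su) u1.
have {}hb : u ^+ (p ^ l) = gamma_comp b (varX p_pr).
  by move: hb; rewrite (frobD p_pr) ?pcharE // expr1n => /addrI.
have b0 : b != 0.
  apply: contraNneq u0 => b0; apply/eqP/(@frob_inj _ _ _ _ l).
  rewrite expr0n -[(_ ^ _ == 0)%N]negbK -lt0n pX_gt0 //= hb b0.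
  by apply: (addrI 1); rewrite (gamma_nat 0 ltr01 (@varX_ge _ p_pr)) expr0 addr0.
have [s [c [cU bE]]] := padic_factor b0.
(* From u^(p^l) = gamma_c(X^(p^s)), a p^l-th root is taken by injectivity of Frobenius. *)
exists c, (s%:Z - l%:Z); split => //; apply: (@frob_inj _ _ _ _ l).
rewrite hb bE -(gamma_mul _ _ ltr01 (@varX_ge _ p_pr)) gamma_varX.
have [ls|sl] := leqP l s.
  rewrite subzn //= -(@gamma_frobX _ _ _ _ 1) //; last first.
    apply: (@eqX_le _ _ ((p ^ (s - l))%:R * 1)); last exact/eqX_X0/varX_ge.
    by rewrite mulr1 ler1n pX_gt0.
  by rewrite -exprM -expnD subnK.
have -> : s%:Z - l%:Z = Negz (l - s).-1 by rewrite NegzE; lia.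
rewrite /= prednK ?subn_gt0 // -(gamma_frobX _ _ (T_gt0 p_pr _) (@rootX_ge _ _ _)).
rewrite /varX (Defs.rootX_root p_pr 0 (l - s)) addn0 -exprM -expnD.
by rewrite subnK // ltnW.
Qed.
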